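(* Let $C'\ge 2$ and $m\ge 10$ be integers, let $f:\mathcal X\to\mathbb R^d$ be a fixed feature map and let $D_1,\dots,D_{C'}$ be class-conditional distributions on $\mathcal X$, with the standing assumptions listed in the context (in particular $d_{ij}>0$, finite fourth moments, and $d_{ij}^2+\frac{v_j-v_i}{m}>0$ for all $i\neq j$). For $i\neq j$ define $E^1_{ij}:=\frac{4}{m}\bigl(V_{ij}^2+\tfrac14 V_{ij}\bigr)$, $E^2_{ij}:=\frac{V_{ij}}{m}$, $E^3_{ij}:=\frac{\Theta_{ij}+2(m-1)V_{ij}^2}{m^3}$. Then the average multiclass error of the $m$-shot NCC classifier satisfies \[ \mathrm{err}^{\mathrm{NCC}}_{m}(f)\le \frac{1}{C'}\sum_{i=1}^{C'}\sum_{j\neq i}\frac{4\tilde V_{ij}}{\bigl(1+\frac{v_j-v_i}{m d_{ij}^2}\bigr)^2}+\frac{1}{C'}\sum_{i=1}^{C'}\sum_{j\neq i}\frac{\bigl(\sqrt{E^1_{ij}}+\sqrt{E^2_{ij}}+\sqrt{E^3_{ij}}\bigr)^2}{\bigl(1+\frac{v_j-v_i}{m d_{ij}^2}\bigr)^2}. \]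
   Context: Setup (nearest-class-centroid few-shot classification). Fix $f:\mathcal X\to\mathbb R^d$ and distributions $D_1,\dots,D_{C'}$ on $\mathcal X$. For a class $c$, let $z_c=f(x)$ with $x\sim D_c$, $\mu_c:=\mathbb E[z_c]$, $\Sigma_c:=\mathrm{Cov}(z_c)$, $v_c:=\mathrm{tr}(\Sigma_c)=\mathbb E\|z_c-\mu_c\|_2^2$, and $M_{4,c}:=\mathbb E\|z_c-\mu_c\|_2^4$, assumed finite. For each class $c$ draw a support set $x_{c,1},\dots,x_{c,m}$ i.i.d. from $D_c$, independently across classes; let $\widehat\mu_c:=\frac1m\sum_{s=1}^m f(x_{c,s})$. Given a test feature $z$, NCC predicts $\widehat y(z)\in\arg\min_{c}\|z-\widehat\mu_c\|_2^2$ with an arbitrary fixed tie-breaking rule. The error is $\mathrm{err}^{\mathrm{NCC}}_m(f):=\frac1{C'}\sum_{i=1}^{C'}\Pr(\widehat y(z_i)\neq i)$, where $z_i=f(x_i)$, $x_i\sim D_i$ independent of the support sets, and the probability is over both support sets and test point. For $i\neq j$: $d_{ij}:=\|\mu_j-\mu_i\|_2$ (assumed $>0$), $u_{ij}:=(\mu_j-\mu_i)/d_{ij}$, directional CDNV $\tilde V_{ij}:=\frac{u_{ij}^\top\Sigma_i u_{ij}}{d_{ij}^2}$, CDNV $V_{ij}:=\frac{v_i+v_j}{d_{ij}^2}$, and $\Theta_{ij}:=\frac{M_{4,i}+M_{4,j}}{d_{ij}^4}$. With $\Delta_{i\to j}:=\|z_i-\widehat\mu_j\|_2^2-\|z_i-\widehat\mu_i\|_2^2$,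 one has $\mathbb E[\Delta_{i\to j}]=d_{ij}^2+\frac{v_j-v_i}{m}$, which is assumed positive for all $i\neq j$. *)

(* Defs.v *)
From HB Require Import structures.
From mathcomp Require Import all_boot all_order all_algebra.
From mathcomp Require Import all_classical all_reals all_analysis.
Set Implicit Arguments. Unset Strict Implicit. Unset Printing Implicit Defensive.
Import Order.TTheory GRing.Theory Num.Theory.
Local Open Scope classical_set_scope.
Local Open Scope ring_scope.

Section NCC.
Context {R : realType} {dX dO : measure_display}
  {X : measurableType dX} {Omega : measurableType dO}.
Variables (C m d : nat).

Definition sqnorm (v : 'rV[R]_d) : R := \sum_(k < d) (v 0 k) ^+ 2.

Variables (f : X -> 'rV[R]_d) (D : 'I_C -> probability X R).

Definition mu (c : 'I_C) : 'rV[R]_d :=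
  \row_k fine (\int[D c]_x (f x 0 k)%:E).

Definition Sigma (c : 'I_C) : 'M[R]_d :=
  \matrix_(k, l) fine (\int[D c]_x
     ((f x 0 k - mu c 0 k) * (f x 0 l - mu c 0 l))%:E).

Definition vv (c : 'I_C) : R := \tr (Sigma c).

Definition M4 (c : 'I_C) : R :=
  fine (\int[D c]_x ((sqnorm (f x - mu c)) ^+ 2)%:E).

Definition dd (i j : 'I_C) : R := Num.sqrt (sqnorm (mu j - mu i)).
Definition uu (i j : 'I_C) : 'rV[R]_d := (dd i j)^-1 *: (mu j - mu i).

Definition Vtil (i j : 'I_C) : R :=
  ((uu i j *m Sigma i *m (uu i j)^T) 0 0) / (dd i j ^+ 2).
Definition VV (i j : 'I_C) : R := (vv i + vv j) / (dd i j ^+ 2).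
Definition Theta (i j : 'I_C) : R := (M4 i + M4 j) / (dd i j ^+ 4).

Definition E1 (i j : 'I_C) : R := 4 / m%:R * (VV i j ^+ 2 + VV i j / 4).
Definition E2 (i j : 'I_C) : R := VV i j / m%:R.
Definition E3 (i j : 'I_C) : R :=
  (Theta i j + 2 * (m.-1)%:R * VV i j ^+ 2) / (m%:R ^+ 3).

Definition denom (i j : 'I_C) : R :=
  (1 + (vv j - vv i) / (m%:R * dd i j ^+ 2)) ^+ 2.

Definition ncc_bound : R :=
  (C%:R)^-1 * \sum_(i < C) \sum_(j < C | j != i) (4 * Vtil i j / denom i j)
  + (C%:R)^-1 * \sum_(i < C) \sum_(j < C | j != i)
      ((Num.sqrt (E1 i j) + Num.sqrt (E2 i j) + Num.sqrt (E3 i j)) ^+ 2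
        / denom i j).

Variables (P : probability Omega R)
  (S : 'I_C -> 'I_m -> Omega -> X)  (* support samples x_{c,s} *)
  (T : 'I_C -> Omega -> X).         (* test point x_i ~ D_i *)

Definition muhat (c : 'I_C) (w : Omega) : 'rV[R]_d :=
  (m%:R)^-1 *: \sum_(s < m) f (S c s w).

Definition argmin_set (z : 'rV[R]_d) (w : Omega) : {set 'I_C} :=
  [set c | [forall c', sqnorm (z - muhat c w) <= sqnorm (z - muhat c' w)]].

Definition tie_breaking (tb : {set 'I_C} -> 'I_C) : Prop :=
  forall A : {set 'I_C}, A != finset.set0 -> tb A \in A.

Definition yhat (tb : {set 'I_C} -> 'I_C) (z : 'rV[R]_d) (w : Omega) : 'I_C :=
  tb (argmin_set z w).

Definition errNCC (tb : {set 'I_C} -> 'I_C) : \bar R :=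
  ((C%:R)^-1)%:E *
  (\sum_(i < C) P [set w | yhat tb (f (T i w)) w != i])%E.

Definition mutually_independent (I : finType) (Y : I -> Omega -> X) : Prop :=
  forall A : I -> set X, (forall k, measurable (A k)) ->
    P (\bigcap_(k in [set: I]) (Y k @^-1` A k)) =
    (\prod_(k : I) P (Y k @^-1` A k))%E.

Definition family_i (i : 'I_C) : option ('I_C * 'I_m) -> Omega -> X :=
  fun k => match k with None => T i | Some cs => S cs.1 cs.2 end.

End NCC.

(* Main.v *)
Require Import Defs.
From HB Require Import structures.
From mathcomp Require Import all_boot all_order all_algebra.
From mathcomp Require Import all_classical all_reals all_analysis.
From mathcomp Require Import measurable_realfun ring lra.
Import Order.TTheory GRing.Theory Num.Theory.
Local Open Scope classical_set_scope.
Local Open Scope ring_scope.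

(** A misclassification of class [i] forces [Delta_{i->j} <= 0] for some
    [j <> i], so Chebyshev's inequality and a union bound reduce everything to
    [Var Delta_{i->j}].  In terms of the centred test feature and the centred
    support features, [Delta_{i->j}] minus its mean is a sum of functions of a
    single sample plus multiples of inner products of two distinct samples;
    by independence these terms are pairwise orthogonal in L2, so the variance
    is the sum of their second moments.  The only mixed term left is, for each
    support point of class [j], the covariance of its squared norm with its
    projection on [mu_i - mu_j], which Cauchy-Schwarz bounds by the product
    [sqrt E2 * sqrt E3] up to a factor absorbed by [sqrt E1 >= sqrt E2]. *)

Set Implicit Arguments.
Unset Strict Implicit.
Unset Printing Implicit Defensive.

(** * Expectation of products of independent variables *)

(** Let [a] be the centred test feature, [bi] and [bj] the centred support means of the two classes,
    and [delta = mu i - mu j]. The margin is [|a + delta - bj|^2 - |a - bi|^2], in which [|a|^2]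
    cancels. Hence the test point enters only to first order, and fourth moments come from support
    points alone, with total weight [1/m^3] per class. Orthogonality rests on one remark: in a
    product of two distinct terms some sample carries a single centred factor, and its zero mean
    kills the expectation. The obstacle is that independence is given for preimages of measurable
    sets only, so it has to be raised to products of integrable functions of the samples. The linear
    test term [2 <delta, a>] has second moment [4 d^4 Vtil], the source of the first sum of the
    bound; [denom] is the squared mean margin divided by [d^4]. *)

Section integral_indep.
Import HBNNSimple.

(** The last hypothesis says weakly that the conditional expectation of [G] given [Y] is the
    constant [c]. Simple functions and monotone convergence extend it from indicators to [g]. The
    integrals are extended-real, so that integrability of the product can be read off afterwards. *)
Lemma integral_indep_ge0 (R : realType) (dX dO : measure_display)
  (X : measurableType dX) (Omega : measurableType dO)
  (P : probability Omega R) (Y : Omega -> X) (G : Omega -> R) (g : X -> R)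
  (c : R) :
  measurable_fun setT Y -> measurable_fun setT G -> (forall w, 0 <= G w) ->
  measurable_fun setT g -> (forall x, 0 <= g x) ->
  (forall A, measurable A ->
    (\int[P]_w (\1_A (Y w) * G w)%:E = c%:E * P (Y @^-1` A))%E) ->
  (\int[P]_w (g (Y w) * G w)%:E = c%:E * \int[P]_w (g (Y w))%:E)%E.
Proof.
move=> mY mG G0 mg g0 H.
have c0 : (0 <= c%:E)%E.
  have := H setT measurableT; rewrite preimage_setT probability_setT mule1 => <-.
  by apply: integral_ge0 => w _; rewrite lee_fin mulr_ge0.
have mg' : measurable_fun setT (EFin \o g : X -> \bar R) by exact/measurable_EFinP.
pose gn := nnsfun_approx measurableT mg'.
have gn_cvg x : EFin \o gn^~ x @ \oo --> (g x)%:E.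
  by apply: (cvg_nnsfun_approx measurableT mg') => // y _; rewrite /= lee_fin.
have gn_nd : nondecreasing_seq (gn : (X -> R)^nat) by exact: nd_nnsfun_approx.
have mgn n : measurable_fun setT (fun w => gn n (Y w)).
  by apply: measurableT_comp mY.
have Hn n : (\int[P]_w (gn n (Y w) * G w)%:E = c%:E * \int[P]_w (gn n (Y w))%:E)%E.
  have gnE w : gn n (Y w) = \sum_(r \in range (gn n)) r * \1_(gn n @^-1` [set r]) (Y w).
    by rewrite fimfunE.
  (* This is required for every real [r], even a negative one: wherever the indicator is one, [r] is
     a value of the nonnegative function [gn n]. *)
  have ind_ge0 r w : (0 <= (r * \1_(gn n @^-1` [set r]) (Y w)))%R.
    rewrite indicE; case: (boolP (_ \in _)) => [|_]; last by rewrite mulr0.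
    by rewrite inE /= mulr1 => <-.
  have mind r : measurable_fun setT (fun w => \1_(gn n @^-1` [set r]) (Y w) : R).
    by apply: measurableT_comp mY; exact: measurable_indic.
  under eq_integral do rewrite gnE mulr_fsuml -fsumEFin//.
  under [in RHS]eq_integral do rewrite gnE -fsumEFin//.
  rewrite !ge0_integral_fsum//.
  - rewrite ge0_mule_fsumr; last by move=> r; apply: integral_ge0 => w _; rewrite lee_fin.
    apply: eq_fsbigr => r rr.
    have r0 : 0 <= r by move: rr; rewrite inE => -[x _ <-].
    under eq_integral do rewrite -mulrA EFinM.
    under [in RHS]eq_integral do rewrite EFinM.
    rewrite !ge0_integralZl_EFin//.
    + rewrite H// muleCA; congr (_ * (_ * _))%E.
      rewrite (_ : (fun x => _) = (fun w => (\1_(Y @^-1` (gn n @^-1` [set r])) w)%:E)).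
        by rewrite integral_indic// ?setIT // -[X in measurable X]setTI; exact: mY.
      by apply/funext => w; rewrite !indicE.
    + by apply/measurable_EFinP.
    + by move=> w _; rewrite lee_fin mulr_ge0.
    + by apply/measurable_EFinP; apply: measurable_funM.
  - by move=> r; apply/measurable_EFinP; apply: measurable_funM.
  - by move=> r w _; rewrite lee_fin.
  - by move=> r; apply/measurable_EFinP; do 2 apply: measurable_funM => //.
  - by move=> r w _; rewrite lee_fin mulr_ge0.
have L1 : (\int[P]_w (gn n (Y w) * G w)%:E @[n --> \oo] -->
           \int[P]_w (g (Y w) * G w)%:E)%E.
  have := @cvg_monotone_convergence _ _ _ P setT measurableT
    (fun n w => (gn n (Y w) * G w)%:E).
  rewrite (_ : (fun x => limn _) = (fun w => (g (Y w) * G w)%:E)).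
    apply.
    - by move=> n; apply/measurable_EFinP/measurable_funM.
    - by move=> n w _; rewrite lee_fin mulr_ge0.
    - move=> w _ m n mn; rewrite lee_fin ler_wpM2r//.
      by have /lefP := gn_nd _ _ mn; exact.
  apply/funext => w; apply/cvg_lim => //.
  under eq_fun do rewrite EFinM; rewrite EFinM.
  by apply: cvgeZr => //; exact: gn_cvg.
have L2 : (\int[P]_w (gn n (Y w))%:E @[n --> \oo] -->
           \int[P]_w (g (Y w))%:E)%E.
  have := @cvg_monotone_convergence _ _ _ P setT measurableT
    (fun n w => (gn n (Y w))%:E).
  rewrite (_ : (fun x => limn _) = (fun w => (g (Y w))%:E)).
    apply.
    - by move=> n; apply/measurable_EFinP.
    - by move=> n w _; rewrite lee_fin.
    - move=> w _ m n mn; rewrite lee_fin.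
      by have /lefP := gn_nd _ _ mn; exact.
  by apply/funext => w; apply/cvg_lim => //; exact: gn_cvg.
rewrite -(cvg_lim _ L1)//; apply/cvg_lim => //.
under eq_fun do rewrite Hn.
exact: cvgeZl.
Qed.

End integral_indep.

(** * Calculus of real-valued expectations *)

Section expectation_toolbox.
Context {R : realType} {dO : measure_display} {Omega : measurableType dO}.
Variable P : probability Omega R.
Implicit Types X Y Z : Omega -> R.

Definition intble X : Prop := P.-integrable setT (EFin \o X).

Lemma intble_measurable X : intble X -> measurable_fun setT X.
Proof. by move=> /integrableP[mX _]; apply/measurable_EFinP. Qed.

Lemma eq_intble X Y : X =1 Y -> intble X -> intble Y.
Proof. by move=> /funext ->. Qed.

Lemma eq_Ex X Y : X =1 Y -> \int[P]_w X w = \int[P]_w Y w.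
Proof. by move=> /funext ->. Qed.

Lemma le_intble X Y : measurable_fun setT X ->
  (forall w, `|X w| <= `|Y w|) -> intble Y -> intble X.
Proof.
move=> mX XY iY; apply: (le_integrable measurableT _ _ iY).
  exact/measurable_EFinP.
by move=> w _; rewrite /= lee_fin.
Qed.

Lemma intbleD X Y : intble X -> intble Y -> intble (fun w => X w + Y w).
Proof. by move=> iX iY; exact: (integrableD measurableT iX iY). Qed.

Lemma intbleZ a X : intble X -> intble (fun w => a * X w).
Proof. by move=> iX; exact: (integrableZl measurableT a iX). Qed.

Lemma intble_norm X : intble X -> intble (fun w => `|X w|).
Proof. by move=> iX; exact: (integrable_norm iX). Qed.

Lemma intble_cst a : intble (fun=> a).
Proof. exact: finite_measure_integrable_cst. Qed.

Lemma intble_sum (I : Type) (s : seq I) (F : I -> Omega -> R) :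
  (forall i, intble (F i)) -> intble (fun w => \sum_(i <- s) F i w).
Proof.
move=> iF; elim: s => [|i s IH].
  by apply: eq_intble (intble_cst 0) => w; rewrite big_nil.
by apply: eq_intble (intbleD (iF i) IH) => w; rewrite big_cons.
Qed.

Lemma ExD X Y : intble X -> intble Y ->
  \int[P]_w (X w + Y w) = \int[P]_w X w + \int[P]_w Y w.
Proof. by move=> iX iY; exact: RintegralD. Qed.

Lemma ExZ a X : intble X -> \int[P]_w (a * X w) = a * \int[P]_w X w.
Proof. by move=> iX; exact: RintegralZl. Qed.

Lemma Ex_cst a : \int[P]_w a = a.
Proof. by rewrite Rintegral_cst//= probability_setT mulr1. Qed.

Lemma Ex_sum (I : Type) (s : seq I) (F : I -> Omega -> R) :
  (forall i, intble (F i)) ->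
  \int[P]_w (\sum_(i <- s) F i w) = \sum_(i <- s) \int[P]_w F i w.
Proof.
move=> iF; elim: s => [|i s IH].
  by under eq_Ex do rewrite big_nil; rewrite big_nil Ex_cst.
under eq_Ex do rewrite big_cons.
by rewrite big_cons ExD ?IH//; exact: intble_sum.
Qed.

Lemma EFin_Ex X : intble X -> (\int[P]_w X w)%:E = (\int[P]_w (X w)%:E)%E.
Proof. by move=> iX; rewrite fineK//; exact: integrable_fin_num. Qed.

Lemma le_Ex X Y : intble X -> intble Y -> (forall w, X w <= Y w) ->
  \int[P]_w X w <= \int[P]_w Y w.
Proof. by move=> iX iY XY; apply: le_Rintegral. Qed.

Section one_variable.
Context {dX : measure_display} {X : measurableType dX}.
Variable Y : Omega -> X.
Hypothesis mY : measurable_fun setT Y.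
Implicit Types (G : Omega -> R) (g : X -> R).

Lemma intble_indic G A : measurable A -> intble G ->
  intble (fun w => \1_A (Y w) * G w).
Proof.
move=> mA iG; apply: (le_intble _ _ iG) => [|w].
  apply: measurable_funM; last exact: intble_measurable iG.
  by apply: measurableT_comp mY; exact: measurable_indic.
by rewrite normrM indicE; case: (_ \in _); rewrite ?normr1 ?mul1r// normr0 mul0r.
Qed.

Lemma Ex_indic A : measurable A ->
  (\int[P]_w (\1_A (Y w)))%:E = P (Y @^-1` A).
Proof.
move=> mA; have mYA : measurable (Y @^-1` A).
  by rewrite -[X in measurable X]setTI; exact: mY.
rewrite -[RHS](fineK (fin_num_measure P _ mYA)); congr (fine _)%:E.
rewrite (_ : (fun x => _) = (fun w => (\1_(Y @^-1` A) w)%:E)).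
  by rewrite integral_indic// setIT.
by apply/funext => w; rewrite !indicE.
Qed.

(** The extended-real identity has a finite right-hand side, which is what makes the product
    integrable. *)
Lemma Ex_indep_ge0 G g c : intble G -> (forall w, 0 <= G w) ->
  measurable_fun setT g -> (forall x, 0 <= g x) -> intble (g \o Y) ->
  (forall A, measurable A ->
     \int[P]_w (\1_A (Y w) * G w) = c * \int[P]_w (\1_A (Y w))) ->
  intble (fun w => g (Y w) * G w) /\
  \int[P]_w (g (Y w) * G w) = c * \int[P]_w g (Y w).
Proof.
move=> iG G0 mg g0 ig H.
have E : (\int[P]_w (g (Y w) * G w)%:E = c%:E * \int[P]_w (g (Y w))%:E)%E.
  apply: integral_indep_ge0 => //; first exact: intble_measurable iG.
  by move=> A mA; rewrite -EFin_Ex ?H ?EFinM ?Ex_indic//; exact: intble_indic.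
have iGg : intble (fun w => g (Y w) * G w).
  apply/integrableP; split.
    apply/measurable_EFinP/measurable_funM; last exact: intble_measurable iG.
    exact: measurableT_comp mY.
  under eq_integral do rewrite /= ger0_norm ?mulr_ge0//.
  by rewrite E -(EFin_Ex ig) -EFinM ltry.
by split => //; apply/EFin_inj; rewrite EFin_Ex// E EFinM (EFin_Ex ig).
Qed.

(* The hypothesis on [`|G|] gives the integrability of [g (Y w) * G w] and
   transfers the one on [G] to its positive and negative parts. *)
Lemma Ex_indep G g c c' : intble G ->
  measurable_fun setT g -> intble (g \o Y) ->
  (forall A, measurable A ->
     \int[P]_w (\1_A (Y w) * G w) = c * \int[P]_w (\1_A (Y w))) ->
  (forall A, measurable A ->
     \int[P]_w (\1_A (Y w) * `|G w|) = c' * \int[P]_w (\1_A (Y w))) ->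
  intble (fun w => g (Y w) * G w) /\
  \int[P]_w (g (Y w) * G w) = c * \int[P]_w g (Y w).
Proof.
move=> iG mg ig H H'.
(* The sign [e = 1] gives the positive part and [e = -1] the negative part, so one argument serves
   both; [gpart] does the same for [g]. *)
have part e (e2 : e ^+ 2 = 1) : [/\ intble (fun w => (`|G w| + e * G w) / 2),
    (forall w, 0 <= (`|G w| + e * G w) / 2) &
    forall A, measurable A -> \int[P]_w (\1_A (Y w) * ((`|G w| + e * G w) / 2))
      = (c' + e * c) / 2 * \int[P]_w (\1_A (Y w))].
  have [iG' iN] := (intbleZ e iG, intble_norm iG).
  split.
  - have := intbleZ 2^-1 (intbleD iN iG'); apply: eq_intble => w; by rewrite mulrC.
  - move=> w; rewrite divr_ge0// -[X in 0 <= _ + X]opprK subr_ge0.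
    have e1 : `|e| = 1 by apply/eqP; rewrite -sqrp_eq1// real_normK ?num_real// e2.
    by rewrite (le_trans (ler_norm _))// normrN normrM e1 mul1r.
  - move=> A mA.
    have [iA iA'] := (intble_indic mA iG, intble_indic mA iN).
    rewrite (@eq_Ex _ (fun w =>
      2^-1 * (\1_A (Y w) * `|G w|) + (e / 2) * (\1_A (Y w) * G w))).
      2: by move=> w; field.
    by rewrite ExD ?ExZ// ?H ?H'//; [field|exact: intbleZ|exact: intbleZ].
have gpart e (e2 : e ^+ 2 = 1) : [/\
    measurable_fun setT (fun x => (`|g x| + e * g x) / 2),
    (forall x, 0 <= (`|g x| + e * g x) / 2) &
    intble ((fun x => (`|g x| + e * g x) / 2) \o Y)].
  split.
  - apply: measurable_funM => //; apply: measurable_funD.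
      exact: measurableT_comp.
    exact: measurable_funM.
  - move=> w; rewrite divr_ge0// -[X in 0 <= _ + X]opprK subr_ge0.
    have e1 : `|e| = 1 by apply/eqP; rewrite -sqrp_eq1// real_normK ?num_real// e2.
    by rewrite (le_trans (ler_norm _))// normrN normrM e1 mul1r.
  - have := intbleZ 2^-1 (intbleD (intble_norm ig) (intbleZ e ig)); apply: eq_intble => w.
    by rewrite /= mulrC.
have one2 : (1 : R) ^+ 2 = 1 by rewrite expr1n.
have mone2 : (-1 : R) ^+ 2 = 1 by rewrite sqrrN expr1n.
have [iGp Gp0 HGp] := part _ one2.
have [iGn Gn0 HGn] := part _ mone2.
have [mgp gp0 igp] := gpart _ one2.
have [mgn gn0 ign] := gpart _ mone2.
have [ipp Epp] := Ex_indep_ge0 iGp Gp0 mgp gp0 igp HGp.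
have [ipn Epn] := Ex_indep_ge0 iGn Gn0 mgp gp0 igp HGn.
have [inp Enp] := Ex_indep_ge0 iGp Gp0 mgn gn0 ign HGp.
have [inn Enn] := Ex_indep_ge0 iGn Gn0 mgn gn0 ign HGn.
have dec w : g (Y w) * G w = ((`|g (Y w)| + 1 * g (Y w)) / 2 * ((`|G w| + 1 * G w) / 2) +
   -1 * ((`|g (Y w)| + 1 * g (Y w)) / 2 * ((`|G w| + -1 * G w) / 2))) +
   (-1 * ((`|g (Y w)| + -1 * g (Y w)) / 2 * ((`|G w| + 1 * G w) / 2)) +
   (`|g (Y w)| + -1 * g (Y w)) / 2 * ((`|G w| + -1 * G w) / 2)) by field.
have gdec w : g (Y w) = (`|g (Y w)| + 1 * g (Y w)) / 2 +
    -1 * ((`|g (Y w)| + -1 * g (Y w)) / 2).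
  by field.
have i1 := intbleD ipp (intbleZ (-1) ipn).
have i2 := intbleD (intbleZ (-1) inp) inn.
split; first by apply: eq_intble (intbleD i1 i2) => w; rewrite dec.
under eq_Ex do rewrite dec.
rewrite ExD// ExD ?ExZ//; last exact: intbleZ.
rewrite ExD ?ExZ//; last exact: intbleZ.
rewrite Epp Epn Enp Enn.
under [in RHS]eq_Ex do rewrite gdec.
rewrite ExD ?ExZ//; last exact: intbleZ.
set u := Rintegral _ _ _; set v := Rintegral _ _ _.
by field.
Qed.

End one_variable.
End expectation_toolbox.

(** * Product rule for finite independent families *)

Section independent_products.
Context {R : realType} {dX dO : measure_display}
  {X : measurableType dX} {Omega : measurableType dO}.
Variables (P : probability Omega R) (I : finType) (Y : I -> Omega -> X).
Hypothesis mY : forall k, measurable_fun setT (Y k).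
Hypothesis indY : mutually_independent P Y.

(** The product of the indicators is the indicator of the intersection of the preimages, so this is
    the definition of independence. *)
Lemma Ex_prod_indic (A : I -> set X) : (forall k, measurable (A k)) ->
  intble P (fun w => \prod_k \1_(A k) (Y k w)) /\
  \int[P]_w (\prod_k \1_(A k) (Y k w)) =
    \prod_k \int[P]_w (\1_(A k) (Y k w)).
Proof.
move=> mA; set B := \bigcap_(k in [set: I]) (Y k @^-1` A k).
have mB : measurable B.
  apply: fin_bigcap_measurable; first exact: finite_finset.
  by move=> k _; rewrite -[X in measurable X]setTI; exact: mY.
have E w : \prod_k \1_(A k) (Y k w) = \1_B w :> R.
  rewrite indicE; case: (boolP (w \in B)) => [|/negP nB].
    rewrite inE => wB; apply: big1 => k _; rewrite indicE mem_set//.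
    exact: (wB k).
  have [k kA] : exists k, ~ A k (Y k w).
    apply: contrapT => H; apply: nB; rewrite inE => k _.
    by apply: contrapT => kA; apply: H; exists k.
  by rewrite (bigD1 k)//= indicE memNset// mul0r.
have iB : intble P (\1_B).
  exact: integrable_indic.
split; first by apply: eq_intble iB => w; rewrite E.
apply/EFin_inj.
rewrite (eq_Ex P (Y := \1_B))// (@Ex_indic _ _ _ P _ _ id)//.
rewrite indY// -prodEFin; apply: eq_bigr => k _.
by rewrite Ex_indic.
Qed.

Lemma Ex_prod (g : I -> X -> R) :
  (forall k, measurable_fun setT (g k)) ->
  (forall k, intble P (g k \o Y k)) ->
  intble P (fun w => \prod_k g k (Y k w)) /\
  \int[P]_w (\prod_k g k (Y k w)) = \prod_k \int[P]_w (g k (Y k w)).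
Proof.
(* Indicators are replaced by arbitrary integrable functions one index at a
   time. *)
suff H (s : seq I) : forall h : I -> X -> R,
  (forall k, measurable_fun setT (h k)) ->
  (forall k, intble P (h k \o Y k)) ->
  (forall k, k \notin s -> exists2 A, measurable A & h k = \1_A) ->
  intble P (fun w => \prod_k h k (Y k w)) /\
  \int[P]_w (\prod_k h k (Y k w)) = \prod_k \int[P]_w (h k (Y k w)).
  by move=> mg ig; apply: (H (enum I)) => // k; rewrite mem_enum.
elim: s => [|k s IH] h mh ih hind.
  have /choice[A hA] : forall k, exists A, measurable A /\ h k = \1_A.
    by move=> k; have [//|A mA ->] := hind k; exists A.
  have [iA EA] := @Ex_prod_indic A (fun k => (hA k).1).
  split.
    apply: eq_intble iA => w.
    by apply: eq_bigr => k _; rewrite (hA k).2.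
  rewrite -[RHS](eq_bigr _ (fun k _ =>
    congr1 (fun f => \int[P]_w f (Y k w)) (esym (hA k).2))) -EA.
  by apply: eq_Ex => w; apply: eq_bigr => k _; rewrite (hA k).2.
(* Putting an indicator at [k] brings the family under the induction hypothesis for [s]. This yields
   the indicator identity that [Ex_indep] requires, with [G] the product of the other factors. *)
pose upd (h : I -> X -> R) (A : set X) l : X -> R := if l == k then \1_A else h l.
have updk f A : upd f A k = \1_A by rewrite /upd eqxx.
have updN f A l : l != k -> upd f A l = f l by rewrite /upd => /negPf ->.
have updE (f : I -> X -> R) A w : \prod_l upd f A l (Y l w) =
    \1_A (Y k w) * \prod_(l | l != k) f l (Y l w).
  rewrite (bigD1 k)//= updk; congr (_ * _).
  by apply: eq_bigr => l lk; rewrite updN.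
have IHu (f : I -> X -> R) : (forall l, measurable_fun setT (f l)) ->
    (forall l, intble P (f l \o Y l)) ->
    (forall l, l \notin k :: s -> exists2 A, measurable A & f l = \1_A) ->
    forall A, measurable A ->
    intble P (fun w => \1_A (Y k w) * \prod_(l | l != k) f l (Y l w)) /\
    \int[P]_w (\1_A (Y k w) * \prod_(l | l != k) f l (Y l w)) =
    (\prod_(l | l != k) \int[P]_w (f l (Y l w))) * \int[P]_w (\1_A (Y k w)).
  move=> mf intf indf A mA.
  have [] := IH (upd f A).
  - by move=> l; rewrite /upd; case: ifP => // _; exact: measurable_indic.
  - move=> l; rewrite /upd; case: eqP => [->|//].
    have := intble_indic (mY k) mA (intble_cst P 1).
    by apply: eq_intble => w; rewrite mulr1.
  - move=> l ls; rewrite /upd; case: eqVneq => [_|lk]; first by exists A.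
    by apply: indf; rewrite inE negb_or lk.
  move=> iu Eu; split; first by apply: eq_intble iu => w; rewrite updE.
  under eq_Ex do rewrite -updE.
  rewrite Eu (bigD1 k)//= updk mulrC; congr (_ * _).
  by apply: eq_bigr => l lk; rewrite updN.
have [iG _] := IHu h mh ih hind setT measurableT.
have {}iG : intble P (fun w => \prod_(l | l != k) h l (Y l w)).
  by apply: eq_intble iG => w; rewrite indicE in_setT mul1r.
have [] := @Ex_indep _ _ _ P _ _ _ (mY k) (fun w => \prod_(l | l != k) h l (Y l w)) (h k)
  (\prod_(l | l != k) \int[P]_w (h l (Y l w)))
  (\prod_(l | l != k) \int[P]_w (`|h l (Y l w)|)) iG (mh k) (ih k).
- by move=> A mA; have [] := IHu h mh ih hind A mA.
(* The identity for [|G|] is the same statement for the family of absolute values: the norm of a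
   product is the product of the norms, and indicators are unchanged. *)
- move=> A mA; have [] := IHu (fun l x => `|h l x|) _ _ _ A mA.
  + by move=> l; exact: measurableT_comp.
  + by move=> l; have := intble_norm (ih l).
  + move=> l ls; have [B mB ->] := hind l ls; exists B => //.
    by apply/funext => x; rewrite ger0_norm.
  by move=> _ <-; apply: eq_Ex => w; rewrite normr_prod.
move=> iP EP; split; first by apply: eq_intble iP => w; rewrite [RHS](bigD1 k).
under eq_Ex do rewrite (bigD1 k)//=.
by rewrite EP [RHS](bigD1 k)//= mulrC.
Qed.

End independent_products.

(** Lagrange's identity: the double sum of the squares [(a p * b q - a q * b p) ^+ 2] is twice the
    difference of the two sides. *)
Lemma sqr_sum_mul_le (R : realFieldType) (I : finType) (a b : I -> R) :
  (\sum_p a p * b p) ^+ 2 <= (\sum_p a p ^+ 2) * (\sum_p b p ^+ 2).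
Proof.
have : 0 <= \sum_p \sum_q (a p * b q - a q * b p) ^+ 2.
  by apply: sumr_ge0 => p _; apply: sumr_ge0 => q _; exact: sqr_ge0.
have -> : \sum_p \sum_q (a p * b q - a q * b p) ^+ 2 =
    2 * ((\sum_p a p ^+ 2) * (\sum_p b p ^+ 2) - (\sum_p a p * b p) ^+ 2).
  transitivity (\sum_p \sum_q (a p ^+ 2 * b q ^+ 2) + \sum_p \sum_q (b p ^+ 2 * a q ^+ 2)
    - 2 * \sum_p \sum_q ((a p * b p) * (a q * b q))).
    rewrite mulr_sumr -sumrN -!big_split; apply: eq_bigr => p _ /=.
    rewrite mulr_sumr -sumrN -!big_split; apply: eq_bigr => q _ /=.
    ring.
  rewrite expr2 -!big_distrlr /=; ring.
by rewrite pmulr_rge0// subr_ge0.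
Qed.

(** * Square-integrable random variables *)

Section square_integrable.
Context {R : realType} {dO : measure_display} {Omega : measurableType dO}.
Variable P : probability Omega R.
Implicit Types X Y : Omega -> R.

Definition sqintble X : Prop :=
  measurable_fun setT X /\ intble P (fun w => X w ^+ 2).

Lemma eq_sqintble X Y : X =1 Y -> sqintble X -> sqintble Y.
Proof. by move=> /funext ->. Qed.

Lemma intbleM X Y : sqintble X -> sqintble Y -> intble P (fun w => X w * Y w).
Proof.
move=> [mX iX] [mY iY]; apply: (le_intble _ _ (intbleD iX iY)) => [|w].
  exact: measurable_funM.
rewrite [leRHS]ger0_norm ?addr_ge0 ?sqr_ge0// ler_norml.
have := sqr_ge0 (X w + Y w); have := sqr_ge0 (X w - Y w).
have := sqr_ge0 (X w); have := sqr_ge0 (Y w).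
rewrite !sqrrD sqrrN mulrN mulNrn => *; apply/andP; split; lra.
Qed.

Lemma sqintble_cst a : sqintble (fun=> a).
Proof. by split; [exact: measurable_cst|exact: intble_cst]. Qed.

Lemma sqintble_intble X : sqintble X -> intble P X.
Proof.
move=> sX; apply: eq_intble (intbleM sX (sqintble_cst 1)) => w.
by rewrite mulr1.
Qed.

Lemma sqintbleZ a X : sqintble X -> sqintble (fun w => a * X w).
Proof.
move=> [mX iX]; split; first exact: measurable_funM.
by apply: eq_intble (intbleZ (a ^+ 2) iX) => w; rewrite exprMn.
Qed.

Lemma sqintbleD X Y : sqintble X -> sqintble Y -> sqintble (fun w => X w + Y w).
Proof.
move=> sX sY; split; first exact: measurable_funD sX.1 sY.1.
have := intbleD (intbleD sX.2 sY.2) (intbleZ 2 (intbleM sX sY)).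
by apply: eq_intble => w; ring.
Qed.

Lemma sqintble_sum (I : Type) (s : seq I) (F : I -> Omega -> R) :
  (forall i, sqintble (F i)) -> sqintble (fun w => \sum_(i <- s) F i w).
Proof.
move=> sF; elim: s => [|i s IH].
  by apply: eq_sqintble (sqintble_cst 0) => w; rewrite big_nil.
by apply: eq_sqintble (sqintbleD (sF i) IH) => w; rewrite big_cons.
Qed.

Lemma Ex_sqr_sum_orthogonal (J : finType) (F : J -> Omega -> R) :
  (forall i, sqintble (F i)) ->
  (forall i j, i != j -> \int[P]_w (F i w * F j w) = 0) ->
  \int[P]_w ((\sum_i F i w) ^+ 2) = \sum_i \int[P]_w (F i w ^+ 2).
Proof.
move=> sF oF.
under eq_Ex do rewrite expr2 mulr_suml.
rewrite Ex_sum; last first.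
  by move=> i; apply: intbleM => //; exact: sqintble_sum.
apply: eq_bigr => i _; under eq_Ex do rewrite mulr_sumr.
rewrite Ex_sum; last by move=> j; exact: intbleM.
rewrite (bigD1 i)//= big1 ?addr0//.
by move=> j ji; rewrite oF// eq_sym.
Qed.

Lemma Ex_CauchySchwarz X Y : sqintble X -> sqintble Y ->
  (\int[P]_w (X w * Y w)) ^+ 2 <= \int[P]_w (X w ^+ 2) * \int[P]_w (Y w ^+ 2).
Proof.
move=> sX sY; set a := \int[P]_w (X w ^+ 2); set b := \int[P]_w (Y w ^+ 2).
set c := \int[P]_w (X w * Y w).
have b0 : 0 <= b by apply: Rintegral_ge0 => w _; exact: sqr_ge0.
(* Nonnegativity of [E (s X + t Y)^2]. Two parameters avoid a division: [s = b], [t = - c] gives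
   [b (a b - c^2) >= 0], which settles the case [b > 0]. *)
have H s t : 0 <= s ^+ 2 * a + 2 * s * t * c + t ^+ 2 * b.
  have -> : s ^+ 2 * a + 2 * s * t * c + t ^+ 2 * b =
      \int[P]_w ((s * X w + t * Y w) ^+ 2).
    rewrite (@eq_Ex _ _ _ _ _ (fun w => s ^+ 2 * X w ^+ 2 +
      (2 * s * t * (X w * Y w) + t ^+ 2 * Y w ^+ 2))).
      2: by move=> w; ring.
    have [i1 i2 i3] := And3 (intbleZ (s ^+ 2) sX.2)
      (intbleZ (2 * s * t) (intbleM sX sY)) (intbleZ (t ^+ 2) sY.2).
    by rewrite ExD ?ExZ ?ExD ?ExZ ?addrA//; first
      [exact: intbleD|exact: intbleM|case: sX|case: sY].
  by apply: Rintegral_ge0 => w _; exact: sqr_ge0.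
have [b00|b_gt0] : b = 0 \/ 0 < b.
  by move: b0; rewrite le_eqVlt => /predU1P[<-|]; [left|right].
  rewrite b00 mulr0; have [->|c0] := eqVneq c 0; first by rewrite expr0n.
  (* For [b = 0] the form is affine in [t]; this [t] makes it equal to [a - (a + 1) = -1], a
     contradiction. *)
  have := H 1 (- (a + 1) / (2 * c)).
  rewrite b00 mulr0 addr0 expr1n mul1r mulr1.
  rewrite (_ : 2 * _ * c = - (a + 1)); last by field.
  by lra.
have := H b (- c); rewrite (_ : _ + _ = b * (a * b - c ^+ 2)); last by ring.
by rewrite pmulr_rge0// subr_ge0.
Qed.

End square_integrable.

(** * Quadratic forms in independent centred vectors *)

Section quadratic_forms.
Context {R : realType} {dX dO : measure_display}
  {X : measurableType dX} {Omega : measurableType dO}.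
Variables (P : probability Omega R) (I : finType) (Y : I -> Omega -> X).
Hypothesis mY : forall k, measurable_fun setT (Y k).
Hypothesis indY : mutually_independent P Y.

(** Padding with the constant function [1] outside [s] reduces this to the product over all
    indices. *)
Lemma Ex_prod_seq (s : seq I) (g : I -> X -> R) : uniq s ->
  (forall k, k \in s -> measurable_fun setT (g k)) ->
  (forall k, k \in s -> intble P (g k \o Y k)) ->
  intble P (fun w => \prod_(k <- s) g k (Y k w)) /\
  \int[P]_w (\prod_(k <- s) g k (Y k w)) =
    \prod_(k <- s) \int[P]_w (g k (Y k w)).
Proof.
move=> us mg ig; pose h k : X -> R := if k \in s then g k else fun=> 1.
have E w : \prod_k h k (Y k w) = \prod_(k <- s) g k (Y k w).
  rewrite [RHS]big_uniq//= [RHS]big_mkcond; apply: eq_bigr => k _.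
  by rewrite /h; case: ifP.
have [] := Ex_prod mY indY (g := h).
- by move=> k; rewrite /h; case: ifP => // ks; exact: mg.
- move=> k; rewrite /h; case: ifP => ks; first exact: ig.
  exact: intble_cst.
move=> iP EP; split; first exact: eq_intble iP.
under eq_Ex do rewrite -E.
rewrite EP [RHS]big_uniq//= [RHS]big_mkcond; apply: eq_bigr => k _.
by rewrite /h; case: ifP => // _; rewrite Ex_cst.
Qed.

Lemma ExM2 k l (u v : X -> R) : k != l ->
  measurable_fun setT u -> measurable_fun setT v ->
  intble P (u \o Y k) -> intble P (v \o Y l) ->
  intble P (fun w => u (Y k w) * v (Y l w)) /\
  \int[P]_w (u (Y k w) * v (Y l w)) =
    \int[P]_w (u (Y k w)) * \int[P]_w (v (Y l w)).
Proof.
move=> kl mu mv iu iv; pose g x := if x == k then u else v.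
have gk : g k = u by rewrite /g eqxx.
have gl : g l = v by rewrite /g eq_sym (negPf kl).
have [] := @Ex_prod_seq [:: k; l] g.
- by rewrite /= inE kl.
- by move=> x; rewrite !inE => /orP[]/eqP->; rewrite ?gk ?gl.
- by move=> x; rewrite !inE => /orP[]/eqP->; rewrite ?gk ?gl.
under eq_Ex do rewrite !big_cons big_nil gk gl mulr1.
rewrite !big_cons big_nil gk gl mulr1 => iP ->; split => //.
by apply: eq_intble iP => w; rewrite !big_cons big_nil gk gl mulr1.
Qed.

Lemma ExM3_eq0 k l m (u v t : X -> R) : k != l -> k != m -> l != m ->
  measurable_fun setT u -> measurable_fun setT v -> measurable_fun setT t ->
  intble P (u \o Y k) -> intble P (v \o Y l) -> intble P (t \o Y m) ->
  \int[P]_w (u (Y k w)) = 0 ->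
  \int[P]_w (u (Y k w) * (v (Y l w) * t (Y m w))) = 0.
Proof.
move=> kl km lm mu mv mt iu iv it u0.
pose g x := if x == k then u else if x == l then v else t.
have gk : g k = u by rewrite /g eqxx.
have gl : g l = v by rewrite /g eq_sym (negPf kl) eqxx.
have gm : g m = t by rewrite /g eq_sym (negPf km) eq_sym (negPf lm).
have [] := @Ex_prod_seq [:: k; l; m] g.
- by rewrite /= !inE negb_or kl km lm.
- by move=> x; rewrite !inE => /or3P[]/eqP->; rewrite ?gk ?gl ?gm.
- by move=> x; rewrite !inE => /or3P[]/eqP->; rewrite ?gk ?gl ?gm.
under eq_Ex do rewrite !big_cons big_nil gk gl gm mulr1.
by rewrite !big_cons big_nil gk u0 mul0r => _ ->.
Qed.

Lemma ExM4_eq0 k l m n (u v t r : X -> R) :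
  k != l -> k != m -> k != n -> l != m -> l != n -> m != n ->
  measurable_fun setT u -> measurable_fun setT v ->
  measurable_fun setT t -> measurable_fun setT r ->
  intble P (u \o Y k) -> intble P (v \o Y l) ->
  intble P (t \o Y m) -> intble P (r \o Y n) ->
  \int[P]_w (u (Y k w)) = 0 ->
  \int[P]_w (u (Y k w) * (v (Y l w) * (t (Y m w) * r (Y n w)))) = 0.
Proof.
move=> kl km kn lm ln mn mu mv mt mr iu iv it ir u0.
pose g x := if x == k then u else if x == l then v else if x == m then t else r.
have gk : g k = u by rewrite /g eqxx.
have gl : g l = v by rewrite /g eq_sym (negPf kl) eqxx.
have gm : g m = t by rewrite /g eq_sym (negPf km) eq_sym (negPf lm) eqxx.
have gn : g n = r.
  by rewrite /g eq_sym (negPf kn) eq_sym (negPf ln) eq_sym (negPf mn).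
have [] := @Ex_prod_seq [:: k; l; m; n] g.
- by rewrite /= !inE !negb_or kl km kn lm ln mn.
- by move=> x; rewrite !inE => /or4P[]/eqP->; rewrite ?gk ?gl ?gm ?gn.
- by move=> x; rewrite !inE => /or4P[]/eqP->; rewrite ?gk ?gl ?gm ?gn.
under eq_Ex do rewrite !big_cons big_nil gk gl gm gn mulr1.
by rewrite !big_cons big_nil gk u0 mul0r => _ ->.
Qed.

Variables (d : nat) (z : I -> 'I_d -> X -> R) (h : I -> X -> R).
Hypothesis mz : forall k p, measurable_fun setT (z k p).
Hypothesis sz : forall k p, sqintble P (z k p \o Y k).
Hypothesis z0 : forall k p, \int[P]_w (z k p (Y k w)) = 0.
Hypothesis mh : forall k, measurable_fun setT (h k).
Hypothesis sh : forall k, sqintble P (h k \o Y k).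
Hypothesis h0 : forall k, \int[P]_w (h k (Y k w)) = 0.

Definition cross_dot k l w := \sum_p z k p (Y k w) * z l p (Y l w).
Definition second_moment k := \int[P]_w (\sum_p z k p (Y k w) ^+ 2).

Let iz k p : intble P (z k p \o Y k). Proof. exact: sqintble_intble. Qed.
Let ih k : intble P (h k \o Y k). Proof. exact: sqintble_intble. Qed.

Lemma cross_dotC k l w : cross_dot k l w = cross_dot l k w.
Proof. by apply: eq_bigr => p _; rewrite mulrC. Qed.

(** By independence the square splits into a product of two integrable squares, so second moments of
    the coordinates suffice. *)
Lemma sqintble_cross_coord k l p : k != l ->
  sqintble P (fun w => z k p (Y k w) * z l p (Y l w)).
Proof.
move=> kl; split.
  by apply: measurable_funM; apply: measurableT_comp.
have [] := @ExM2 k l (fun x => z k p x ^+ 2) (fun x => z l p x ^+ 2) kl.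
- exact: measurable_funX.
- exact: measurable_funX.
- exact: (sz k p).2.
- exact: (sz l p).2.
by move=> iP _; apply: eq_intble iP => w; rewrite exprMn.
Qed.

Lemma sqintble_cross_dot k l : k != l -> sqintble P (cross_dot k l).
Proof. by move=> kl; apply: sqintble_sum => p; exact: sqintble_cross_coord. Qed.

Lemma Ex_lin_lin k l : k != l -> \int[P]_w (h k (Y k w) * h l (Y l w)) = 0.
Proof.
by move=> kl; have [_ ->] := ExM2 kl (mh k) (mh l) (ih k) (ih l); rewrite h0 mul0r.
Qed.

(** At least one of [a] and [b] differs from [k], and the coordinate at that index is a lone centred
    factor. If the other one equals [k], it merges with [h k] into one function of sample [k],
    integrable as a product of square-integrable factors. *)
Lemma Ex_lin_cross k a b : a != b ->
  \int[P]_w (h k (Y k w) * cross_dot a b w) = 0.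
Proof.
have main x y : x != y -> k != y -> \int[P]_w (h k (Y k w) * cross_dot x y w) = 0.
  move=> xy ky; under eq_Ex do rewrite mulr_sumr.
  rewrite Ex_sum; last first.
    by move=> p; apply: intbleM; [exact: sh|exact: sqintble_cross_coord].
  apply: big1 => p _; have [kx|kx] := eqVneq k x.
    subst x.
    have yk : y != k by rewrite eq_sym.
    have [||_] := @ExM2 y k (z y p) (fun t => h k t * z k p t) yk (mz y p) _ (iz y p).
    - exact: measurable_funM.
    - exact: (intbleM (sh k) (sz k p)).
    rewrite z0 mul0r => <-; apply: eq_Ex => w; ring.
  by apply: ExM3_eq0.
move=> ab; have [kb|kb] := eqVneq k b; last exact: main.
under eq_Ex do rewrite cross_dotC.
by apply: main; rewrite ?kb eq_sym.
Qed.

(** The index [a] occurs in one pair only, so [z a p] is a lone centred factor. The cases ask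
    whether [b] meets the second pair, which leaves three or four distinct samples. *)
Lemma Ex_cross_cross a b c e : a != b -> c != e -> a != c -> a != e ->
  \int[P]_w (cross_dot a b w * cross_dot c e w) = 0.
Proof.
move=> ab ce ac ae; under eq_Ex do rewrite mulr_suml.
rewrite Ex_sum; last first.
  move=> p; apply: intbleM; first exact: sqintble_cross_coord.
  exact: sqintble_cross_dot.
apply: big1 => p _; under eq_Ex do rewrite mulr_sumr.
rewrite Ex_sum; last by move=> q; apply: intbleM; exact: sqintble_cross_coord.
apply: big1 => q _; have [bc|bc] := eqVneq b c.
  subst c; rewrite -[RHS](@ExM3_eq0 a b e (z a p) (fun x => z b p x * z b q x) (z e q))//.
  - by apply: eq_Ex => w; ring.
  - exact: measurable_funM.
  - exact: (intbleM (sz b p) (sz b q)).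
have [be|be] := eqVneq b e.
  subst e; rewrite -[RHS](@ExM3_eq0 a b c (z a p) (fun x => z b p x * z b q x) (z c q))//.
  - by apply: eq_Ex => w; ring.
  - exact: measurable_funM.
  - exact: (intbleM (sz b p) (sz b q)).
rewrite -[RHS](@ExM4_eq0 a b c e (z a p) (z b p) (z c q) (z e q))//.
by apply: eq_Ex => w; ring.
Qed.

(** Cauchy-Schwarz holds pointwise in the coordinates, and the squared norms of two distinct samples
    are independent. *)
Lemma Ex_cross_sqr_le k l : k != l ->
  \int[P]_w (cross_dot k l w ^+ 2) <= second_moment k * second_moment l.
Proof.
move=> kl; pose n k x := \sum_p z k p x ^+ 2.
have mn j : measurable_fun setT (n j).
  by apply: measurable_sum => p; exact: measurable_funX.
have isn j : intble P (n j \o Y j) by apply: intble_sum => p; exact: (sz j p).2.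
have [iP EP] := ExM2 kl (mn k) (mn l) (isn k) (isn l).
rewrite -EP; apply: le_Ex => //; first exact: (sqintble_cross_dot kl).2.
move=> w; rewrite /cross_dot /n.
exact: sqr_sum_mul_le.
Qed.

(* The support of [alpha] is a set of oriented pairs: each unordered pair of
   distinct indices carries at most one cross term. *)
Variable alpha : I -> I -> R.
Hypothesis alpha_orient : forall k l, alpha k l != 0 -> k != l /\ alpha l k = 0.

Definition quad_form w :=
  \sum_k h k (Y k w) + \sum_(kl : I * I) alpha kl.1 kl.2 * cross_dot kl.1 kl.2 w.

(** One index type for both kinds of terms lets [Ex_sqr_sum_orthogonal] treat the whole sum at
    once. *)
Let term (t : I + I * I) w := match t with
  | inl k => h k (Y k w)
  | inr kl => alpha kl.1 kl.2 * cross_dot kl.1 kl.2 w end.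

Let quad_formE w : quad_form w = \sum_t term t w.
Proof. by rewrite big_sumType. Qed.

Let sterm t : sqintble P (term t).
Proof.
case: t => [k|[k l]] /=; first exact: sh.
have [a0|a0] := eqVneq (alpha k l) 0.
  by apply: eq_sqintble (sqintble_cst P 0) => w; rewrite /= a0 mul0r.
by apply: sqintbleZ; apply: sqintble_cross_dot; case: (alpha_orient a0).
Qed.

Lemma sqintble_quad_form : sqintble P quad_form.
Proof.
by apply: eq_sqintble (sqintble_sum (index_enum _) sterm) => w; rewrite quad_formE.
Qed.

Let oterm t u : t != u -> \int[P]_w (term t w * term u w) = 0.
Proof.
have Z X1 X2 c : \int[P]_w (X1 w * X2 w) = 0 :> R -> intble P (fun w => X1 w * X2 w) ->
    \int[P]_w (X1 w * (c * X2 w)) = 0.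
  move=> E0 iX; rewrite -[RHS](mulr0 c) -E0 -ExZ//.
  by apply: eq_Ex => w; rewrite mulrCA.
have linc k a b : \int[P]_w (term (inl k) w * term (inr (a, b)) w) = 0.
  rewrite /=; have [->|a0] := eqVneq (alpha a b) 0.
    by under eq_Ex do rewrite mul0r mulr0; rewrite Ex_cst.
  have [ab _] := alpha_orient a0.
  apply: Z; first exact: Ex_lin_cross.
  by apply: intbleM; [exact: sh|exact: sqintble_cross_dot].
case: t u => [k|[a b]] [l|[c e]].
- by move=> kl; apply: Ex_lin_lin; apply: contra_neq kl => ->.
- by move=> _; exact: linc.
- by move=> _; under eq_Ex do rewrite mulrC; exact: linc.
move=> ne; rewrite /=; have [->|a0] := eqVneq (alpha a b) 0.
  by under eq_Ex do rewrite mul0r mul0r; rewrite Ex_cst.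
have [->|c0] := eqVneq (alpha c e) 0.
  by under eq_Ex do rewrite mul0r mulr0; rewrite Ex_cst.
have [ab ba] := alpha_orient a0; have [ce _] := alpha_orient c0.
have iQ := intbleM (sqintble_cross_dot ab) (sqintble_cross_dot ce).
apply: Z; last first.
  by have := intbleZ (alpha a b) iQ; apply: eq_intble => w; rewrite mulrA.
rewrite (@eq_Ex _ _ _ _ _ (fun w => alpha a b * (cross_dot a b w * cross_dot c e w))).
  2: by move=> w; rewrite mulrA.
rewrite ExZ//; apply/eqP; rewrite mulf_eq0 (negPf a0)/=; apply/eqP.
have [ac|ac] := eqVneq a c; last have [ae|ae] := eqVneq a e.
- subst c; under eq_Ex do rewrite cross_dotC.
  apply: Ex_cross_cross; rewrite // eq_sym//.
  by apply: contra_neq ne => ->.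
(* The lone index is now [b]: if [b] were [c], the second pair would be the first one reversed,
   where the orientation makes [alpha] vanish. *)
- subst e; under eq_Ex do rewrite cross_dotC.
  apply: Ex_cross_cross; rewrite // ?(eq_sym b a)//.
  by apply: contra_neq c0 => <-.
- exact: Ex_cross_cross.
Qed.

Lemma Ex_quad_form_sqr_le :
  \int[P]_w (quad_form w ^+ 2) <= \sum_k \int[P]_w (h k (Y k w) ^+ 2) +
    \sum_(kl : I * I) alpha kl.1 kl.2 ^+ 2 * (second_moment kl.1 * second_moment kl.2).
Proof.
under eq_Ex do rewrite quad_formE.
rewrite Ex_sqr_sum_orthogonal// big_sumType/= lerD2l; apply: ler_sum => -[k l] _ /=.
under eq_Ex do rewrite exprMn.
have [->|a0] := eqVneq (alpha k l) 0.
  by under eq_Ex do rewrite expr0n mul0r; rewrite Ex_cst expr0n mul0r.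
have [kl _] := alpha_orient a0.
rewrite ExZ; last exact: (sqintble_cross_dot kl).2.
by apply: ler_wpM2l; rewrite ?sqr_ge0// Ex_cross_sqr_le.
Qed.

End quadratic_forms.

(** * Transfer between a sample and its law *)

Section law.
Context {R : realType} {dX dO : measure_display}
  {X : measurableType dX} {Omega : measurableType dO}.
Variables (P : probability Omega R) (Q : probability X R) (Y : Omega -> X).
Hypothesis mY : measurable_fun setT Y.
Hypothesis lawY : forall A, measurable A -> P (Y @^-1` A) = Q A.

Lemma intble_law g : intble Q g -> intble P (g \o Y).
Proof.
move=> ig; have mg := intble_measurable ig.
apply/integrableP; split.
  by apply/measurable_EFinP; exact: measurableT_comp mY.
have /integrableP[_] := ig; apply: le_lt_trans.
rewrite [leRHS](@eq_measure_integral _ _ _ _ (pushforward P Y)); last first.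
  by move=> A mA _; exact/esym/lawY.
rewrite ge0_integral_pushforward//.
by apply: measurableT_comp => //; exact/measurable_EFinP.
Qed.

Lemma Ex_law g : intble Q g -> \int[P]_w g (Y w) = \int[Q]_x g x.
Proof.
move=> ig; have mg := intble_measurable ig.
congr fine; rewrite [RHS](@eq_measure_integral _ _ _ _ (pushforward P Y)); last first.
  by move=> A mA _; exact/esym/lawY.
rewrite integral_pushforward//; first exact/measurable_EFinP.
exact: (intble_law ig).
Qed.

Lemma sqintble_law g : sqintble Q g -> sqintble P (g \o Y).
Proof.
move=> [mg ig]; split; first exact: measurableT_comp mY.
exact: (intble_law ig).
Qed.

End law.

(** * Moments of the class-conditional features *)

Section class_moments.
Context {R : realType} {dX : measure_display} {X : measurableType dX}.
Variables (C d : nat) (f : X -> 'rV[R]_d) (D : 'I_C -> probability X R).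
Hypothesis mf : forall k : 'I_d, measurable_fun setT (fun x => f x 0 k).
Hypothesis if1 : forall (c : 'I_C) (k : 'I_d),
  (D c).-integrable setT (fun x => (f x 0 k)%:E).
Hypothesis if4 : forall c : 'I_C,
  (D c).-integrable setT (fun x => ((sqnorm (f x - mu f D c)) ^+ 2)%:E).

Definition dev c k x := f x 0 k - mu f D c 0 k.
Definition sqdev c x := sqnorm (f x - mu f D c) - vv f D c.
Definition lindev (v : 'rV[R]_d) c x := \sum_k v 0 k * dev c k x.

Lemma sqnorm_ge0 (v : 'rV[R]_d) : 0 <= sqnorm v.
Proof. by apply: sumr_ge0 => k _; exact: sqr_ge0. Qed.

Lemma sqnormN (v : 'rV[R]_d) : sqnorm (- v) = sqnorm v.
Proof. by apply: eq_bigr => k _; rewrite mxE sqrrN. Qed.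

Lemma sqnorm_dev c x : sqnorm (f x - mu f D c) = \sum_k dev c k x ^+ 2.
Proof. by apply: eq_bigr => k _; rewrite [in LHS]mxE [X in _ + X]mxE. Qed.

Lemma measurable_dev c k : measurable_fun setT (dev c k).
Proof. exact: measurable_funB. Qed.

Lemma measurable_sqnorm_dev c : measurable_fun setT (fun x => sqnorm (f x - mu f D c)).
Proof.
under eq_fun do rewrite sqnorm_dev.
by apply: measurable_sum => k; apply: measurable_funX; exact: measurable_dev.
Qed.

Lemma sqintble_sqnorm_dev c : sqintble (D c) (fun x => sqnorm (f x - mu f D c)).
Proof. by split; [exact: measurable_sqnorm_dev|exact: if4]. Qed.

(** The assumed fourth moment makes the squared norm square-integrable, hence integrable under a
    probability, and it dominates the square of each coordinate. *)
Lemma sqintble_dev c k : sqintble (D c) (dev c k).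
Proof.
split; first exact: measurable_dev.
apply: (le_intble _ _ (sqintble_intble (sqintble_sqnorm_dev c))) => [|x].
  by apply: measurable_funX; exact: measurable_dev.
rewrite !ger0_norm ?sqnorm_ge0 ?sqr_ge0// sqnorm_dev (bigD1 k)//= lerDl.
by apply: sumr_ge0 => l _; exact: sqr_ge0.
Qed.

Lemma Ex_dev c k : \int[D c]_x dev c k x = 0.
Proof.
rewrite /dev ExD; last 2 first.
  - exact: if1.
  - exact: intble_cst.
rewrite (Ex_cst (D c)); apply/eqP; rewrite subr_eq0; apply/eqP.
by rewrite [RHS]mxE.
Qed.

Lemma Ex_sqnorm_dev c : \int[D c]_x sqnorm (f x - mu f D c) = vv f D c.
Proof.
under eq_Ex do rewrite sqnorm_dev.
rewrite Ex_sum; last by move=> k; exact: (sqintble_dev c k).2.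
by apply: eq_bigr => k _; rewrite mxE; apply: eq_Ex => x; rewrite expr2.
Qed.

Lemma vv_ge0 c : 0 <= vv f D c.
Proof. by rewrite -Ex_sqnorm_dev; apply: Rintegral_ge0 => x _; exact: sqnorm_ge0. Qed.

Lemma M4_ge0 c : 0 <= M4 f D c.
Proof. by apply: fine_ge0; apply: integral_ge0 => x _; rewrite lee_fin sqr_ge0. Qed.

Lemma sqintble_sqdev c : sqintble (D c) (sqdev c).
Proof. exact: sqintbleD (sqintble_sqnorm_dev c) (sqintble_cst _ _). Qed.

Lemma Ex_sqdev c : \int[D c]_x sqdev c x = 0.
Proof.
rewrite /sqdev ExD; last 2 first.
  - exact: sqintble_intble (sqintble_sqnorm_dev c).
  - exact: intble_cst.
by rewrite (Ex_cst (D c)) Ex_sqnorm_dev subrr.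
Qed.

(** The left side is a variance, equal to [M4 - vv^2]. *)
Lemma Ex_sqdev_sqr_le c : \int[D c]_x (sqdev c x ^+ 2) <= M4 f D c.
Proof.
have sq := sqintble_sqnorm_dev c.
rewrite (@eq_Ex _ _ _ _ _ (fun x => sqnorm (f x - mu f D c) ^+ 2 +
  (- 2 * vv f D c * sqnorm (f x - mu f D c) + vv f D c ^+ 2))).
  2: by move=> x; rewrite /sqdev; ring.
have i1 := intbleZ (- 2 * vv f D c) (sqintble_intble sq).
have i2 := intble_cst (D c) (vv f D c ^+ 2).
rewrite ExD ?ExD//; first last.
- exact: intbleD.
- exact: sq.2.
rewrite ExZ; last exact: sqintble_intble.
rewrite (Ex_cst (D c)) Ex_sqnorm_dev.
rewrite [X in X + _](_ : _ = M4 f D c)//.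
by have := sqr_ge0 (vv f D c); lra.
Qed.

Lemma sqintble_lindev v c : sqintble (D c) (lindev v c).
Proof.
by apply: sqintble_sum => k; apply: sqintbleZ; exact: sqintble_dev.
Qed.

Lemma Ex_lindev v c : \int[D c]_x lindev v c x = 0.
Proof.
rewrite Ex_sum; last first.
  by move=> k; apply: intbleZ; apply: sqintble_intble; exact: sqintble_dev.
apply: big1 => k _; rewrite ExZ ?Ex_dev ?mulr0//.
by apply: sqintble_intble; exact: sqintble_dev.
Qed.

Lemma Ex_lindev_sqr v c :
  \int[D c]_x (lindev v c x ^+ 2) = (v *m Sigma f D c *m v^T) 0 0.
Proof.
rewrite (@eq_Ex _ _ _ _ _ (fun x =>
  \sum_k \sum_l v 0 k * v 0 l * (dev c k x * dev c l x))).
  2: move=> x; rewrite expr2 big_distrlr; apply: eq_bigr => k _;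
     apply: eq_bigr => l _ /=; ring.
have iM k l : intble (D c) (fun x => dev c k x * dev c l x).
  by apply: intbleM; exact: sqintble_dev.
rewrite Ex_sum; last by move=> k; apply: intble_sum => l; exact: intbleZ.
rewrite mxE; under [RHS]eq_bigr do rewrite !mxE mulr_suml.
rewrite [RHS]exchange_big; apply: eq_bigr => k _.
rewrite Ex_sum; last by move=> l; exact: intbleZ.
apply: eq_bigr => l _; rewrite ExZ// mxE mulrAC; congr (_ * _).
Qed.

Lemma Ex_lindev_sqr_le v c :
  \int[D c]_x (lindev v c x ^+ 2) <= sqnorm v * vv f D c.
Proof.
have iq := sqintble_intble (sqintble_sqnorm_dev c).
rewrite -Ex_sqnorm_dev -ExZ//; apply: le_Ex.
- exact: (sqintble_lindev v c).2.
- exact: intbleZ.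
- by move=> x; rewrite sqnorm_dev; exact: sqr_sum_mul_le.
Qed.

Lemma dd_sqr i j : dd f D i j ^+ 2 = sqnorm (mu f D i - mu f D j).
Proof. by rewrite sqr_sqrtr ?sqnorm_ge0// -sqnormN opprB. Qed.

(** The factor [d^4] undoes the division by [d^2] and the normalisation of [uu]; a quadratic form
    does not see that [uu] points from [mu i] to [mu j], opposite to the vector used here. *)
Lemma VtilE i j : 0 < dd f D i j -> Vtil f D i j * (dd f D i j ^+ 2) ^+ 2 =
  \int[D i]_x (lindev (mu f D i - mu f D j) i x ^+ 2).
Proof.
move=> d0; rewrite Ex_lindev_sqr /Vtil /uu.
rewrite -(opprB (mu f D i)) scalerN -scaleNr; set v := mu f D i - mu f D j.
rewrite [(_ *: v)^T]linearZ/= -!scalemxAl -scalemxAr scalerA [in LHS]mxE.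
by field; rewrite gt_eqF.
Qed.

End class_moments.

(** * Finite sums over a test point and two support sets *)

Lemma sum_option_bool (V : nmodType) (m : nat) (F : option (bool * 'I_m) -> V) :
  \sum_k F k = F None + (\sum_s F (Some (true, s)) + \sum_s F (Some (false, s))).
Proof.
rewrite (bigD1 None)//=; congr (_ + _).
rewrite (reindex_omap Some id); last by case.
rewrite (eq_bigl xpredT) => [|k]; last by rewrite /= eqxx.
rewrite -(big_bool _ (fun b => \sum_s F (Some (b, s)))) pair_bigA.
by apply: eq_bigr => -[].
Qed.

(** The vanishing assumptions fit the margin: the test point comes first in its pairs, and support
    points of different classes are never multiplied together. *)
Lemma sum_option_bool_pair (V : nmodType) (m : nat)
  (G : option (bool * 'I_m) -> option (bool * 'I_m) -> V) :
  G None None = 0 -> (forall k, G (Some k) None = 0) ->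
  (forall b s t, G (Some (b, s)) (Some (~~ b, t)) = 0) ->
  \sum_(kl : _ * _) G kl.1 kl.2 =
  \sum_s G None (Some (true, s)) + \sum_s G None (Some (false, s)) +
  (\sum_s \sum_t G (Some (true, s)) (Some (true, t)) +
   \sum_s \sum_t G (Some (false, s)) (Some (false, t))).
Proof.
move=> G0 GN Gb; rewrite -(pair_bigA _ (fun k l => G k l))/= sum_option_bool.
rewrite sum_option_bool G0 add0r; congr (_ + (_ + _)).
  apply: eq_bigr => s _; rewrite sum_option_bool GN add0r.
  by rewrite [X in _ + X]big1 ?addr0// => t _; exact: (Gb true).
apply: eq_bigr => s _; rewrite sum_option_bool GN add0r.
by rewrite [X in X + _]big1 ?add0r// => t _; exact: (Gb false).
Qed.

Lemma sqr_sum_lt (R : comPzRingType) (m : nat) (b : 'I_m -> R) :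
  (\sum_s b s) ^+ 2 = \sum_s b s ^+ 2 +
    2 * \sum_(s < m) \sum_(t < m) (if (s < t)%N then b s * b t else 0).
Proof.
have E : \sum_(s < m) \sum_(t < m) (if (t < s)%N then b s * b t else 0) =
    \sum_(s < m) \sum_(t < m) (if (s < t)%N then b s * b t else 0).
  rewrite exchange_big; apply: eq_bigr => s _; apply: eq_bigr => t _.
  by case: ifP => // _; rewrite mulrC.
rewrite mulr2n mulrDl mul1r -{2}E expr2 big_distrlr -!big_split/=.
apply: eq_bigr => s _.
rewrite -big_split/= [in LHS](bigD1 s)//= [in RHS](bigD1 s)//= ltnn addr0 add0r.
congr (_ + _); apply: eq_bigr => t ts.
case: (ltngtP s t) => [||/val_inj]; rewrite ?addr0 ?add0r// => E'.
by rewrite E' eqxx in ts.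
Qed.

Lemma sum_lt_dot (R : comPzRingType) (m d : nat) (c : R) (B : 'I_m -> 'I_d -> R) :
  \sum_(s < m) \sum_(t < m) (if (s < t)%N then c else 0) * (\sum_p B s p * B t p) =
  \sum_p c * (\sum_(s < m) \sum_(t < m)
      (if (s < t)%N then B s p * B t p else 0)).
Proof.
rewrite -[RHS]mulr_sumr [in RHS]exchange_big/= mulr_sumr; apply: eq_bigr => s _.
rewrite [in RHS]exchange_big/= mulr_sumr; apply: eq_bigr => t _.
by case: ifP => // _; rewrite mul0r big1 ?mulr0.
Qed.

Lemma mutually_independent_inj {R : realType} {dX dO : measure_display}
  {X : measurableType dX} {Omega : measurableType dO}
  (P : probability Omega R) (I J : finType) (u : J -> I)
  (Y : I -> Omega -> X) : injective u ->
  mutually_independent P Y -> mutually_independent P (Y \o u).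
Proof.
move=> uinj indY A mA.
(* Indices outside the image of [u] receive the whole space, which contributes a factor of
   probability one. *)
pose B i : set X := if [pick k | u k == i] is Some k then A k else setT.
have Bu k : B (u k) = A k.
  rewrite /B; case: pickP => [l /eqP/uinj->//|/(_ k)].
  by rewrite eqxx.
have BN i : i \notin codom u -> B i = setT.
  move=> iu; rewrite /B; case: pickP => // k /eqP ui.
  by rewrite -ui codom_f in iu.
have := indY B; rewrite (_ : \bigcap_(k in _) _ =
    \bigcap_(k in [set: J]) ((Y \o u) k @^-1` A k)).
  move=> ->; last by move=> i; rewrite /B; case: pickP.
  rewrite (bigID (mem (codom u)))/= [X in (_ * X)%E]big1 ?mule1; last first.
    by move=> i iu; rewrite BN// preimage_setT probability_setT.
  rewrite -big_uniq/=; last by rewrite map_inj_uniq// enum_uniq.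
  by rewrite big_image; apply: eq_bigr => k _; rewrite Bu.
apply/seteqP; split => w /= H i _.
  by have := H (u i) Logic.I; rewrite /preimage/= Bu.
have [/codomP[k ->]|iu] := boolP (i \in codom u); last by rewrite BN.
by rewrite /preimage/= Bu; exact: H.
Qed.

(** * Variance of the margin *)

Section ncc_margin.
Context {R : realType} {dX dO : measure_display}
  {X : measurableType dX} {Omega : measurableType dO}.
Variables (C m d : nat) (f : X -> 'rV[R]_d) (D : 'I_C -> probability X R).
Hypothesis m_gt0 : (0 < m)%N.
Hypothesis mf : forall k : 'I_d, measurable_fun setT (fun x => f x 0 k).
Hypothesis if1 : forall (c : 'I_C) (k : 'I_d),
  (D c).-integrable setT (fun x => (f x 0 k)%:E).
Hypothesis if4 : forall c : 'I_C,
  (D c).-integrable setT (fun x => ((sqnorm (f x - mu f D c)) ^+ 2)%:E).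
Variables (P : probability Omega R)
  (S : 'I_C -> 'I_m -> Omega -> X) (T : 'I_C -> Omega -> X).
Hypothesis mS : forall c s, measurable_fun setT (S c s).
Hypothesis mT : forall i, measurable_fun setT (T i).
Hypothesis lawS : forall c s (A : set X), measurable A -> P (S c s @^-1` A) = D c A.
Hypothesis lawT : forall i (A : set X), measurable A -> P (T i @^-1` A) = D i A.
Variables i j : 'I_C.
Hypothesis neq_ij : i != j.
Hypothesis ind : mutually_independent P (family_i S T i).

(* [None] is the test point; [Some (true, s)] and [Some (false, s)] are the
   support points of classes [i] and [j]. *)
Let J : finType := option (bool * 'I_m).

Definition pair_index (k : J) : option ('I_C * 'I_m) :=
  omap (fun bs : bool * 'I_m => (if bs.1 then i else j, bs.2)) k.

Definition pair_class (k : J) : 'I_C := if k is Some (false, _) then j else i.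

Let Y := family_i S T i \o pair_index.

Let mY k : measurable_fun setT (Y k).
Proof. by case: k => [[b s]|]; [exact: mS|exact: mT]. Qed.

Let indY : mutually_independent P Y.
Proof.
apply: mutually_independent_inj ind => -[[b s]|] [[c t]|]//= [] + <-.
case: b c => -[]// /eqP; first by rewrite (negPf neq_ij).
by rewrite eq_sym (negPf neq_ij).
Qed.

Let lawY k A : measurable A -> P (Y k @^-1` A) = D (pair_class k) A.
Proof. by case: k => [[[] s]|]; [exact: lawS|exact: lawS|exact: lawT]. Qed.

Let delta := mu f D i - mu f D j.

Definition margin w :=
  sqnorm (f (T i w) - muhat f S j w) - sqnorm (f (T i w) - muhat f S i w).

Definition mean_margin := dd f D i j ^+ 2 + (vv f D j - vv f D i) / m%:R.

Let z (k : J) p x := dev f D (pair_class k) p x.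

(** The one-sample terms of [|a + delta - bj|^2 - |a - bi|^2]. Only the first square is shifted by
    [delta], so class [i] support points have no linear term; centring the squared norms produces
    [(vj - vi)/m] in the mean. *)
Let h (k : J) x : R := match k with
  | None => 2 * lindev f D delta i x
  | Some (true, _) => - (m%:R ^- 2) * sqdev f D i x
  | Some (false, _) => m%:R ^- 2 * sqdev f D j x - 2 / m%:R * lindev f D delta j x
  end.

(** The products of distinct samples in [-2 <a, bj> + 2 <a, bi> + |bj|^2 - |bi|^2]. Taking only
    [s < t] doubles the coefficient [1/m^2] and orients the pairs. *)
Let alpha (k l : J) : R := match k, l with
  | None, Some (b, _) => if b then 2 / m%:R else - (2 / m%:R)
  | Some (b, s), Some (c, t) =>
      if (b == c) && (s < t)%N then
        if b then - (2 / m%:R ^+ 2) else 2 / m%:R ^+ 2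
      else 0
  | _, None => 0
  end.

Let alpha_orient k l : alpha k l != 0 -> k != l /\ alpha l k = 0.
Proof.
case: k l => [[b s]|] [[c t]|]//=; rewrite ?eqxx//.
case: ifP; last by rewrite eqxx.
move=> /andP[/eqP -> st] _; split.
  by apply: contraTneq st => -[->]; rewrite ltnn.
by rewrite (ltnNge t) ltnW// andbF.
Qed.

Let m0 : m%:R != 0 :> R. Proof. by rewrite pnatr_eq0 -lt0n. Qed.

Lemma muhat_dev c w k : muhat f S c w 0 k =
  mu f D c 0 k + m%:R^-1 * \sum_s dev f D c k (S c s w).
Proof.
rewrite mxE summxE /dev sumrB big_const cardE size_enum_ord iter_addr_0.
by rewrite mulrBr -[mu _ _ _ _ _ *+ m]mulr_natl mulKf// addrC subrK.
Qed.

Lemma marginE w : margin w = mean_margin + quad_form Y z h alpha w.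
Proof.
pose A p := dev f D i p (T i w).
pose B s p := dev f D i p (S i s w).
pose E s p := dev f D j p (S j s w).
pose e p := delta 0 p.
have -> : margin w = \sum_p ((A p + e p - m%:R^-1 * \sum_s E s p) ^+ 2
    - (A p - m%:R^-1 * \sum_s B s p) ^+ 2).
  rewrite /margin -sumrN -big_split; apply: eq_bigr => p _ /=.
  have subE (u v : 'rV[R]_d) : (u - v) 0 p = u 0 p - v 0 p by rewrite !mxE.
  by rewrite !subE !muhat_dev /A /B /E /e /delta subE /dev; ring.
rewrite /quad_form sum_option_bool.
rewrite (sum_option_bool_pair (G := fun k l =>
  alpha k l * cross_dot Y z k l w)); first last.
- by move=> b s t /=; case: b; rewrite /= mul0r.
- by case=> b s; rewrite /= mul0r.
- by rewrite mul0r.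
rewrite /mean_margin dd_sqr.
(* Each block is rewritten as a sum over coordinates, up to the constants [vv / m], which cancel
   against the mean; what remains is a polynomial identity in each coordinate. *)
have q0 : h None (Y None w) = \sum_p 2 * (e p * A p).
  by rewrite /h /lindev mulr_sumr.
have q1 : \sum_(s < m) h (Some (true, s)) (Y (Some (true, s)) w) =
    \sum_p (- (m%:R ^- 2) * \sum_s B s p ^+ 2) + vv f D i / m%:R.
  rewrite /= /sqdev -mulr_sumr sumrB big_const cardE size_enum_ord iter_addr_0.
  rewrite (eq_bigr _ (fun s _ => sqnorm_dev f D _ _)).
  rewrite -mulr_sumr [in RHS]exchange_big/=.
  by rewrite /B -mulr_natl; field.
have q2 : \sum_(s < m) h (Some (false, s)) (Y (Some (false, s)) w) =
    \sum_p (m%:R ^- 2 * \sum_s E s p ^+ 2 - 2 / m%:R * (e p * \sum_s E s p))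
     - vv f D j / m%:R.
  have X1 : \sum_p e p * (\sum_s E s p) = \sum_s lindev f D delta j (S j s w).
    by rewrite [RHS]exchange_big; apply: eq_bigr => p _; rewrite mulr_sumr.
  have X2 : \sum_p \sum_s E s p ^+ 2 = \sum_s sqnorm (f (S j s w) - mu f D j).
    by rewrite exchange_big; apply: eq_bigr => s _; rewrite sqnorm_dev.
  rewrite /= /sqdev sumrB -!mulr_sumr sumrB big_const cardE size_enum_ord iter_addr_0.
  rewrite sumrB -!mulr_sumr X1 X2 -mulr_natl /Y /=.
  by field.
have q3 : \sum_(s < m) alpha None (Some (true, s)) *
     cross_dot Y z None (Some (true, s)) w
    = \sum_p 2 / m%:R * (A p * \sum_s B s p).
  rewrite /= -!mulr_sumr exchange_big/=; congr (_ * _).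
  by apply: eq_bigr => p _; rewrite mulr_sumr.
have q4 : \sum_(s < m) alpha None (Some (false, s)) *
     cross_dot Y z None (Some (false, s)) w
    = \sum_p - (2 / m%:R) * (A p * \sum_s E s p).
  rewrite /= -!mulr_sumr exchange_big/=; congr (_ * _).
  by apply: eq_bigr => p _; rewrite mulr_sumr.
have q5 : \sum_s \sum_t alpha (Some (true, s)) (Some (true, t)) *
     cross_dot Y z (Some (true, s)) (Some (true, t)) w
    = \sum_p - (2 / m%:R ^+ 2) * \sum_(s < m) \sum_(t < m)
      (if (s < t)%N then B s p * B t p else 0).
  exact: sum_lt_dot.
have q6 : \sum_s \sum_t alpha (Some (false, s)) (Some (false, t)) *
     cross_dot Y z (Some (false, s)) (Some (false, t)) w
    = \sum_p 2 / m%:R ^+ 2 * \sum_(s < m) \sum_(t < m)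
      (if (s < t)%N then E s p * E t p else 0).
  exact: sum_lt_dot.
rewrite q0 q1 q2 q3 q4 q5 q6.
transitivity (\sum_p (e p ^+ 2 + (2 * (e p * A p) + (- m%:R ^- 2 * (\sum_s B s p ^+ 2) +
   (m%:R ^- 2 * (\sum_s E s p ^+ 2) - 2 / m%:R * (e p * (\sum_s E s p)) +
   (2 / m%:R * (A p * (\sum_s B s p)) + (- (2 / m%:R) * (A p * (\sum_s E s p)) +
   (- (2 / m%:R ^+ 2) * (\sum_(s < m) \sum_(t < m)
      (if (s < t)%N then B s p * B t p else 0)) +
   2 / m%:R ^+ 2 * (\sum_(s < m) \sum_(t < m)
      (if (s < t)%N then E s p * E t p else 0)))))))))).
  apply: eq_bigr => p _.
  (* The sums of squares are eliminated in favour of squared sums and sums over [s < t], which makes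
     the identity purely algebraic. *)
  have [HB HE] := (sqr_sum_lt (B ^~ p), sqr_sum_lt (E ^~ p)).
  move: HB HE; set SB := \sum_s B s p; set SE := \sum_s E s p.
  set QB := \sum_s B s p ^+ 2; set QE := \sum_s E s p ^+ 2.
  set LB := \sum_(s < m) \sum_(t < m)
      (if (s < t)%N then B s p * B t p else 0).
  set LE := \sum_(s < m) \sum_(t < m)
      (if (s < t)%N then E s p * E t p else 0).
  move=> HB HE; rewrite (_ : QB = SB ^+ 2 - 2 * LB); last by rewrite HB addrK.
  rewrite (_ : QE = SE ^+ 2 - 2 * LE); last by rewrite HE addrK.
  by field.
rewrite !big_split/= -/(sqnorm delta).
by ring.
Qed.

Let mz k p : measurable_fun setT (z k p).
Proof. exact: measurable_dev. Qed.

Let sz k p : sqintble P (z k p \o Y k).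
Proof. by apply: (sqintble_law (mY k) (lawY k)); exact: sqintble_dev. Qed.

Let z0 k p : \int[P]_w (z k p (Y k w)) = 0.
Proof.
rewrite (Ex_law (mY k) (lawY k)); first exact: Ex_dev.
by apply: sqintble_intble; exact: sqintble_dev.
Qed.

Let sqintble_h k : sqintble (D (pair_class k)) (h k).
Proof.
case: k => [[[] s]|] /=.
- by apply: sqintbleZ; exact: sqintble_sqdev.
- have := sqintbleD (sqintbleZ (m%:R ^- 2) (sqintble_sqdev mf if4 j))
    (sqintbleZ (- (2 / m%:R)) (sqintble_lindev mf if4 delta j)).
  by apply: eq_sqintble => x; rewrite mulNr.
- by apply: sqintbleZ; exact: sqintble_lindev.
Qed.

Let mh k : measurable_fun setT (h k).
Proof. exact: (sqintble_h k).1. Qed.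

Let sh k : sqintble P (h k \o Y k).
Proof. exact: (sqintble_law (mY k) (lawY k)). Qed.

Let Ex_h k : \int[D (pair_class k)]_x h k x = 0.
Proof.
have iq c := sqintble_intble (sqintble_sqdev mf if4 c).
have il c := sqintble_intble (sqintble_lindev mf if4 delta c).
case: k => [[[] s]|] /=.
- by rewrite ExZ// (Ex_sqdev mf if4) mulr0.
- rewrite (@eq_Ex _ _ _ _ _ (fun x => m%:R ^- 2 * sqdev f D j x +
    - (2 / m%:R) * lindev f D delta j x)); last by move=> x; rewrite mulNr.
  rewrite ExD; [|exact: intbleZ|exact: intbleZ].
  by rewrite !ExZ// (Ex_sqdev mf if4) (Ex_lindev mf if1 if4) !mulr0 addr0.
- by rewrite ExZ// (Ex_lindev mf if1 if4) mulr0.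
Qed.

Let h0 k : \int[P]_w (h k (Y k w)) = 0.
Proof.
by rewrite (Ex_law (mY k) (lawY k)) ?Ex_h//; exact: sqintble_intble.
Qed.

Let Ex_h_sqr k : \int[P]_w (h k (Y k w) ^+ 2) = \int[D (pair_class k)]_x (h k x ^+ 2).
Proof. exact: (Ex_law (mY k) (lawY k) (sqintble_h k).2). Qed.

Let second_momentE k : second_moment P Y z k = vv f D (pair_class k).
Proof.
rewrite -(Ex_sqnorm_dev mf if4) -(Ex_law (mY k) (lawY k)); last first.
  by apply: sqintble_intble; exact: sqintble_sqnorm_dev.
by apply: eq_Ex => w; rewrite sqnorm_dev.
Qed.

Definition sqdev_lindev_cov := \int[D j]_x (sqdev f D j x * lindev f D delta j x).

Lemma sqdev_lindev_cov_sqr_le :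
  sqdev_lindev_cov ^+ 2 <= M4 f D j * (dd f D i j ^+ 2 * vv f D j).
Proof.
apply: le_trans (Ex_CauchySchwarz _ _) _.
- exact: sqintble_sqdev.
- exact: sqintble_lindev.
apply: ler_pM.
- by apply: Rintegral_ge0 => x _; exact: sqr_ge0.
- by apply: Rintegral_ge0 => x _; exact: sqr_ge0.
- exact: Ex_sqdev_sqr_le.
- by rewrite dd_sqr; exact: Ex_lindev_sqr_le.
Qed.

Lemma sqintble_margin : sqintble P (fun w => margin w - mean_margin).
Proof.
have sQ := sqintble_quad_form mY indY mz sz sh alpha_orient.
apply: eq_sqintble sQ => w.
by rewrite marginE addrC addKr.
Qed.

(** The weights are counts times squared coefficients: [m / m^4] for the fourth moments, [m (2/m)^2]
    for the linear terms of class [j] and for the products with the test point, and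
    [(2/m^2)^2 m(m-1)/2] within a support set. The covariance has unknown sign and is kept exact. *)
Lemma margin_variance_le : 0 < dd f D i j ->
  \int[P]_w ((margin w - mean_margin) ^+ 2) <=
  4 * (Vtil f D i j * (dd f D i j ^+ 2) ^+ 2) +
  (M4 f D i / m%:R ^+ 3 +
   (M4 f D j / m%:R ^+ 3 + 4 / m%:R * (dd f D i j ^+ 2 * vv f D j)
     - 4 / m%:R ^+ 2 * sqdev_lindev_cov) +
   4 / m%:R * (vv f D i * (vv f D i + vv f D j)) +
   2 * m.-1%:R / m%:R ^+ 3 * (vv f D i ^+ 2 + vv f D j ^+ 2)).
Proof.
move=> d_gt0.
rewrite (@eq_Ex _ _ _ _ _ (fun w => quad_form Y z h alpha w ^+ 2)); last first.
  by move=> w; rewrite marginE addrC addKr.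
apply: le_trans (Ex_quad_form_sqr_le mY indY mz sz z0 mh sh h0 alpha_orient) _.
rewrite sum_option_bool.
rewrite (sum_option_bool_pair (G := fun k l =>
  alpha k l ^+ 2 * (second_moment P Y z k * second_moment P Y z l))); first last.
- by move=> b s t /=; case: b; rewrite /= expr0n mul0r.
- by case=> b s; rewrite /= expr0n mul0r.
- by rewrite expr0n mul0r.
have mD1 : m%:R = 1 + m.-1%:R :> R by rewrite -{1}(prednK m_gt0) -natr1 addrC.
have minv : 0 <= m%:R^-1 :> R by rewrite invr_ge0.
have sumc (c : R) : \sum_(s < m) c = m%:R * c.
  by rewrite big_const cardE size_enum_ord iter_addr_0 mulr_natl.
(* The number of pairs [s < t], read off from [(1 + ... + 1)^2]. *)
have N : 2 * \sum_(s < m) \sum_(t < m) (if (s < t)%N then 1 else 0) =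
    m%:R * m.-1%:R :> R.
  have := sqr_sum_lt (fun _ : 'I_m => 1 : R).
  rewrite /= (mulr1 1) expr1n !sumc mulr1 => E.
  by apply: (addrI (m%:R : R)); rewrite -E mD1; set q := m.-1%:R; ring.
have lt_sum (c v : R) : \sum_(s < m) \sum_(t < m) (if (s < t)%N then c else 0) ^+ 2 * v =
    c ^+ 2 * v * (m%:R * m.-1%:R / 2).
  rewrite -N [2 * _ / 2]mulrAC divff// mul1r.
  have -> : \sum_(s < m) \sum_(t < m) (if (s < t)%N then c else 0) ^+ 2 * v =
    c ^+ 2 * v * \sum_(s < m) \sum_(t < m) (if (s < t)%N then 1 else 0).
    rewrite mulr_sumr; apply: eq_bigr => s _; rewrite mulr_sumr; apply: eq_bigr => t _.
    by case: ifP => _; rewrite ?mulr1// expr0n mul0r mulr0.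
  by [].
have q0 : \int[P]_w (h None (Y None w) ^+ 2) =
    4 * (Vtil f D i j * (dd f D i j ^+ 2) ^+ 2).
  rewrite Ex_h_sqr (VtilE mf if4)//= -ExZ; last exact: (sqintble_lindev mf if4 _ _).2.
  by apply: eq_Ex => x; rewrite exprMn -natrX.
have q1 s : \int[P]_w (h (Some (true, s)) (Y (Some (true, s)) w) ^+ 2) <=
    M4 f D i / m%:R ^+ 4.
  rewrite Ex_h_sqr /=; under eq_Ex do rewrite exprMn.
  rewrite ExZ; last exact: (sqintble_sqdev mf if4 _).2.
  rewrite mulrC sqrrN -exprVn -exprM -exprVn.
  apply: ler_wpM2r; last exact: Ex_sqdev_sqr_le.
  by rewrite exprn_ge0.
have q2 s : \int[P]_w (h (Some (false, s)) (Y (Some (false, s)) w) ^+ 2) <=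
    M4 f D j / m%:R ^+ 4 + 4 / m%:R ^+ 2 * (dd f D i j ^+ 2 * vv f D j)
     - 4 / m%:R ^+ 3 * sqdev_lindev_cov.
  have [sq sl] := (sqintble_sqdev mf if4 j, sqintble_lindev mf if4 delta j).
  rewrite Ex_h_sqr /= (@eq_Ex _ _ _ _ _ (fun x => m%:R ^- 4 * (sqdev f D j x ^+ 2) +
    (4 / m%:R ^+ 2 * (lindev f D delta j x ^+ 2) +
     - (4 / m%:R ^+ 3) * (sqdev f D j x * lindev f D delta j x)))).
    2: by move=> x; field.
  have [i1 i2 i3] := And3 (intbleZ (m%:R ^- 4) sq.2)
    (intbleZ (4 / m%:R ^+ 2) sl.2) (intbleZ (- (4 / m%:R ^+ 3)) (intbleM sq sl)).
  rewrite ExD//; last exact: intbleD.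
  rewrite ExD// ExZ; last exact: sq.2.
  rewrite ExZ; last exact: sl.2.
  rewrite ExZ; last exact: intbleM.
  rewrite mulNr addrA lerD2r; apply: lerD.
    rewrite mulrC; apply: ler_wpM2r; last exact: Ex_sqdev_sqr_le.
    by rewrite -exprVn exprn_ge0.
  apply: ler_wpM2l; first by rewrite mulr_ge0// -exprVn exprn_ge0.
  by rewrite dd_sqr; exact: Ex_lindev_sqr_le.
rewrite q0 -addrA lerD2l.
apply: le_trans (lerD (lerD (ler_sum _ (fun s _ => q1 s))
  (ler_sum _ (fun s _ => q2 s))) (lexx _)) _.
have q3 b v : \sum_s \sum_t alpha (Some (b, s)) (Some (b, t)) ^+ 2 * v =
    (2 / m%:R ^+ 2) ^+ 2 * v * (m%:R * m.-1%:R / 2).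
  by case: b; rewrite -lt_sum //; apply: eq_bigr => s _; apply: eq_bigr => t _ /=;
    case: ifP => // _; rewrite sqrrN.
under [X in _ + (_ + (X + _)) <= _]eq_bigr do
  under eq_bigr do rewrite !second_momentE /pair_class.
under [X in _ + (_ + (_ + X)) <= _]eq_bigr do
  under eq_bigr do rewrite !second_momentE /pair_class.
rewrite !q3 !second_momentE /=.
under [X in _ + (X + _ + _) <= _]eq_bigr do rewrite !second_momentE /=.
under [X in _ + (_ + X + _) <= _]eq_bigr do rewrite !second_momentE /=.
rewrite !sumc.
rewrite le_eqVlt; apply/orP; left; apply/eqP.
by field.
Qed.

End ncc_margin.

(** Here [D] stands for the squared distance. In the expanded square, [E1], [E2] and
    [2 sqrt (E1 E2)] contribute at least [1 + 1 + 2] copies of [D (vi + vj) / m], which covers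
    [4 D vj / m]. The rest of [E1] covers [4 vi (vi + vj) / m], [E3] covers the fourth moments and
    the within-class products, and the double products with [sqrt E3] cover the covariance. *)
Lemma ncc_variance_bound (R : rcfType) (m : nat) (D vi vj Mi Mj c V : R) :
  (0 < m)%N -> 0 < D -> 0 <= vi -> 0 <= vj -> 0 <= Mi -> 0 <= Mj ->
  c ^+ 2 <= Mj * (D * vj) ->
  V = (vi + vj) / D ->
  Mi / m%:R ^+ 3 + (Mj / m%:R ^+ 3 + 4 / m%:R * (D * vj) - 4 / m%:R ^+ 2 * c) +
  4 / m%:R * (vi * (vi + vj)) +
  2 * m.-1%:R / m%:R ^+ 3 * (vi ^+ 2 + vj ^+ 2) <=
  D ^+ 2 * (Num.sqrt (4 / m%:R * (V ^+ 2 + V / 4)) + Num.sqrt (V / m%:R) +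
    Num.sqrt (((Mi + Mj) / D ^+ 2 + 2 * m.-1%:R * V ^+ 2) / m%:R ^+ 3)) ^+ 2.
Proof.
move=> m0 D0 vi0 vj0 Mi0 Mj0 hc VE.
have n0 : 0 <= m%:R^-1 :> R by rewrite invr_ge0.
have V0 : 0 <= V by rewrite VE divr_ge0 ?addr_ge0// ltW.
have q0 : 0 <= m.-1%:R :> R by [].
rewrite -!exprVn; set n := (m%:R : R)^-1 in n0 *; set q := m.-1%:R in q0 *.
set E1 := 4 * n * (V ^+ 2 + V / 4); set E2 := V * n.
set E3 := (_ + 2 * q * V ^+ 2) * n ^+ 3.
have VD : V * D = vi + vj by rewrite VE divfK ?gt_eqF.
have E10 : 0 <= E1 
  by apply: mulr_ge0; [exact: mulr_ge0|apply: addr_ge0; [exact: sqr_ge0|exact: divr_ge0]].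
have E20 : 0 <= E2 by rewrite mulr_ge0.
have E30 : 0 <= E3.
  apply: mulr_ge0; last exact: exprn_ge0.
  apply: addr_ge0; last by rewrite !mulr_ge0 ?sqr_ge0.
  by rewrite mulr_ge0 ?addr_ge0// exprn_ge0 ?invr_ge0 ?ltW.
have E12 : E2 <= E1.
  rewrite -subr_ge0 (_ : E1 - E2 = 4 * n * V ^+ 2); last by rewrite /E1 /E2; field.
  by rewrite !mulr_ge0 ?sqr_ge0.
set s1 := Num.sqrt E1; set s2 := Num.sqrt E2; set s3 := Num.sqrt E3.
have [s10 s20 s30] : [/\ 0 <= s1, 0 <= s2 & 0 <= s3] by split; exact: sqrtr_ge0.
have s12 : E2 <= s1 * s2.
  rewrite -[E2](sqr_sqrtr E20) expr2; apply: ler_wpM2r => //.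
  by rewrite ler_sqrt.
have e1 : s1 ^+ 2 = E1 by exact: sqr_sqrtr.
have e2 : s2 ^+ 2 = E2 by exact: sqr_sqrtr.
have e3 : s3 ^+ 2 = E3 by exact: sqr_sqrtr.
have DE3 : D ^+ 2 * E3 = (Mi + Mj + 2 * q * (vi + vj) ^+ 2) * n ^+ 3.
  by rewrite /E3 -VD; field; rewrite gt_eqF.
have B0 : 0 <= D ^+ 2 * ((s1 + s2) * s3).
  by rewrite mulr_ge0 ?sqr_ge0// mulr_ge0 ?addr_ge0.
(* After squaring, [(s1 + s2)^2 >= 4 E2] and [D^2 E3 >= Mj n^3] meet the assumed bound on [c^2]; the
   surplus is a multiple of [vi]. *)
have cross : - (2 * n ^+ 2 * c) <= D ^+ 2 * ((s1 + s2) * s3).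
  apply: le_trans (ler_norm _) _; rewrite -(ger0_norm B0) -ler_sqr ?nnegrE//.
  rewrite !real_normK ?num_real// sqrrN.
  apply: (@le_trans _ _ (4 * n ^+ 4 * (Mj * (D * vj)))).
    rewrite (_ : (2 * n ^+ 2 * c) ^+ 2 = 4 * n ^+ 4 * c ^+ 2); last by ring.
    by apply: ler_wpM2l; rewrite // mulr_ge0 ?exprn_ge0.
  rewrite (_ : (D ^+ 2 * ((s1 + s2) * s3)) ^+ 2 =
    D ^+ 2 * (s1 ^+ 2 + s2 ^+ 2 + 2 * (s1 * s2)) * (D ^+ 2 * s3 ^+ 2)).
    2: ring.
  rewrite e1 e2 e3 DE3.
  apply: (@le_trans _ _ (D ^+ 2 * (4 * E2) * (Mj * n ^+ 3))).
    rewrite (_ : D ^+ 2 * (4 * E2) = 4 * (V * D) * D * n); last by rewrite /E2; ring.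
    rewrite VD -subr_ge0 (_ : _ - _ = 4 * n ^+ 4 * (Mj * (D * vi))); last by ring.
    by rewrite !mulr_ge0 ?exprn_ge0// ltW.
  apply: ler_pM.
  - by apply: mulr_ge0; [exact: sqr_ge0|exact: mulr_ge0].
  - by apply: mulr_ge0 => //; exact: exprn_ge0.
  - by apply: ler_wpM2l; [exact: sqr_ge0|lra].
  - apply: ler_wpM2r; first exact: exprn_ge0.
    by have := mulr_ge0 q0 (sqr_ge0 (vi + vj)); lra.
rewrite (_ : (s1 + s2 + s3) ^+ 2 =
  s1 ^+ 2 + s2 ^+ 2 + 2 * (s1 * s2) + s3 ^+ 2 + 2 * ((s1 + s2) * s3)).
  2: ring.
rewrite e1 e2 e3 !mulrDr DE3.
have D2s : D ^+ 2 * E2 <= D ^+ 2 * (s1 * s2) by rewrite ler_wpM2l ?sqr_ge0.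
have D2E1 : D ^+ 2 * E1 = 4 * n * (vi + vj) ^+ 2 + n * (vi + vj) * D.
  by rewrite /E1 -VD; field.
have D2E2 : D ^+ 2 * E2 = n * (vi + vj) * D by rewrite /E2 -VD; ring.
rewrite D2E1 D2E2 in D2s *.
(* Beyond twice the slacks of [D2s] and [cross], the difference of the two sides is exactly four
   times the sum of these three quantities. *)
have t1 : 0 <= n * vi * D by rewrite !mulr_ge0// ltW.
have t2 : 0 <= n * vj * (vi + vj) by rewrite !mulr_ge0 ?addr_ge0.
have t3 : 0 <= q * n ^+ 3 * (vi * vj) by rewrite !mulr_ge0 ?exprn_ge0.
by nra.
Qed.

(** * Chebyshev's inequality and the union bound *)

Section tail_bounds.
Context {R : realType} {dO : measure_display} {Omega : measurableType dO}.
Variable P : probability Omega R.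

Lemma Ex_indicator (A : set Omega) : measurable A ->
  (\int[P]_w (\1_A w))%:E = P A.
Proof. by move=> mA; exact: (@Ex_indic _ _ _ P _ _ id). Qed.

Lemma measurable_le0 (Z : Omega -> R) : measurable_fun setT Z ->
  measurable [set w | Z w <= 0].
Proof.
move=> mZ; rewrite (_ : [set w | _] = setT `&` Z @^-1` `]-oo, 0]%classic).
  exact: mZ.
by rewrite setTI; apply/seteqP; split => w /=; rewrite in_itv.
Qed.

(** On the event [Z <= 0] the deviation from [e] is at least [e], so [e^2] times the indicator is
    below the squared deviation. *)
Lemma chebyshev_le0 (Z : Omega -> R) (e : R) : 0 < e ->
  measurable_fun setT Z -> sqintble P (fun w => Z w - e) ->
  (P [set w | (Z w <= 0)%R] * (e ^+ 2)%:E <= (\int[P]_w ((Z w - e) ^+ 2))%:E)%E.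
Proof.
move=> e0 mZ sZ; have mA := measurable_le0 mZ.
rewrite -Ex_indicator// -EFinM lee_fin mulrC.
have i1 : intble P (\1_[set w | Z w <= 0] : Omega -> R).
  exact: integrable_indic.
rewrite -ExZ//; apply: le_Ex; [exact: intbleZ|exact: sZ.2|move=> w].
rewrite indicE; case: (boolP (w \in _)) => [|_]; last by rewrite mulr0 sqr_ge0.
rewrite inE /= mulr1 => Z0.
by rewrite -[leRHS]sqrrN opprB lerXn2r ?nnegrE; lra.
Qed.

Lemma measure_bigcup_fin_le (I : finType) (Q : pred I)
  (E : set Omega) (A : I -> set Omega) :
  measurable E -> (forall i, measurable (A i)) ->
  (forall w, E w -> exists2 i, Q i & A i w) ->
  (P E <= \sum_(i | Q i) P (A i))%E.
Proof.
move=> mE mA EA.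
rewrite -Ex_indicator//.
under eq_bigr do rewrite -Ex_indicator//.
rewrite sumEFin lee_fin big_mkcond.
have iI B : measurable B -> intble P (\1_B : Omega -> R).
  by move=> mB; exact: integrable_indic.
(* The factor [(Q i)%:R] turns the restricted sum into one over all indices, as [Ex_sum] expects. *)
pose F i w : R := (Q i)%:R * \1_(A i) w.
have iF i : intble P (F i) by apply: intbleZ; exact: iI.
rewrite (eq_bigr (fun i => \int[P]_w F i w)) => [|i _]; last first.
  rewrite ExZ; last exact: iI.
  by case: (Q i); rewrite ?mul1r ?mul0r.
rewrite -Ex_sum//; apply: le_Ex; [exact: iI|exact: intble_sum|move=> w].
have F0 i : 0 <= F i w by rewrite mulr_ge0.
rewrite indicE; case: (boolP (w \in E)) => [|_]; last by rewrite sumr_ge0.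
rewrite inE => /EA[i Qi Ai].
rewrite (bigD1 i)//= {1}/F Qi mul1r indicE mem_set// lerDl.
by apply: sumr_ge0.
Qed.

End tail_bounds.

(** * From pairwise margins to the multiclass error *)

Unset Implicit Arguments.
Set Strict Implicit.
Set Printing Implicit Defensive.

Theorem theorem1 (R : realType) (dX dO : measure_display)
  (X : measurableType dX) (Omega : measurableType dO)
  (C m d : nat) (hC : (2 <= C)%N) (hm : (10 <= m)%N)
  (f : X -> 'rV[R]_d)
  (hf : forall k : 'I_d, measurable_fun setT (fun x => f x 0 k))
  (D : 'I_C -> probability X R)
  (hint1 : forall (c : 'I_C) (k : 'I_d),
      (D c).-integrable setT (fun x => (f x 0 k)%:E))
  (hint4 : forall c : 'I_C,
      (D c).-integrable setT
        (fun x => ((sqnorm (f x - mu f D c)) ^+ 2)%:E))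
  (hd : forall i j : 'I_C, i != j -> 0 < dd f D i j)
  (hpos : forall i j : 'I_C, i != j ->
      0 < dd f D i j ^+ 2 + (vv f D j - vv f D i) / m%:R)
  (P : probability Omega R)
  (S : 'I_C -> 'I_m -> Omega -> X) (T : 'I_C -> Omega -> X)
  (hS : forall c s, measurable_fun setT (S c s))
  (hT : forall i, measurable_fun setT (T i))
  (hSdist : forall c s (A : set X), measurable A -> P (S c s @^-1` A) = D c A)
  (hTdist : forall i (A : set X), measurable A -> P (T i @^-1` A) = D i A)
  (hindep : forall i : 'I_C, mutually_independent P (family_i S T i))
  (tb : {set 'I_C} -> 'I_C) (htb : tie_breaking tb) :
  (errNCC f P S T tb <= (ncc_bound m f D)%:E)%E.
Proof.
have m0 : (0 < m)%N by exact: leq_trans hm.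
have mn0 : m%:R != 0 :> R by rewrite pnatr_eq0 -lt0n.
have mmuhat c k : measurable_fun setT (fun w => muhat f S c w 0 k).
  rewrite (_ : (fun w => _) = (fun w => m%:R^-1 * \sum_(s < m) f (S c s w) 0 k)).
    apply: measurable_funM => //; apply: measurable_sum => s.
    exact: (measurableT_comp (hf k) (hS c s)).
  by apply/funext => w; rewrite mxE summxE.
have mdist i c : measurable_fun setT (fun w => sqnorm (f (T i w) - muhat f S c w)).
  apply: measurable_sum => k; apply: measurable_funX.
  rewrite (_ : (fun w => _) = (fun w => f (T i w) 0 k - muhat f S c w 0 k)).
    apply: measurable_funB; last exact: mmuhat.
    exact: (measurableT_comp (hf k) (hT i)).
  by apply/funext => w; rewrite mxE [X in _ + X]mxE.
have mmargin i j : measurable_fun setT (margin f S T i j).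
  by apply: measurable_funB; exact: mdist.
pose B i j := (Num.sqrt (E1 m f D i j) + Num.sqrt (E2 m f D i j) +
  Num.sqrt (E3 m f D i j)) ^+ 2.
have pair i j : i != j ->
    (P [set w | (margin f S T i j w <= 0)%R] <=
      (4 * Vtil f D i j / denom m f D i j + B i j / denom m f D i j)%:E)%E.
  move=> ij; have d0 := hd _ _ ij; have d20 : 0 < dd f D i j ^+ 2 by rewrite exprn_gt0.
  have e0 : 0 < mean_margin m f D i j by exact: hpos.
  (* Factoring [d^2] out of the mean makes Chebyshev's denominator [d^4 * denom]; the variance bound
     carries the same [d^4], which cancels. *)
  have e2 : mean_margin m f D i j ^+ 2 = (dd f D i j ^+ 2) ^+ 2 * denom m f D i j.
    rewrite /mean_margin /denom; set x := dd f D i j ^+ 2 in d20 *.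
    by field; rewrite mn0 gt_eqF.
  have den0 : 0 < denom m f D i j.
    by rewrite -(@pmulr_rgt0 _ ((dd f D i j ^+ 2) ^+ 2)) ?exprn_gt0// -e2 exprn_gt0.
  have := chebyshev_le0 e0 (mmargin i j)
    (sqintble_margin m0 hf hint4 hS hT hSdist hTdist ij (hindep i)).
  have mA := measurable_le0 (mmargin i j).
  rewrite -[P _](fineK (fin_num_measure P _ mA)) -EFinM !lee_fin => /le_trans/(_
    (margin_variance_le m0 hf hint1 hint4 hS hT hSdist hTdist ij (hindep i) d0)).
  have := ncc_variance_bound m0 d20 (vv_ge0 hf hint4 i) (vv_ge0 hf hint4 j)
    (M4_ge0 f D i) (M4_ge0 f D j) (sqdev_lindev_cov_sqr_le hf hint4 i j) (erefl _).
  rewrite -exprM => vb /le_trans/(_ (lerD (lexx _) vb)).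
  rewrite e2 -mulrDl ler_pdivlMr// mulrCA mulrA.
  rewrite -exprM (_ : 4 * (_ * _) = dd f D i j ^+ 4 * (4 * Vtil f D i j)); last by ring.
  rewrite -mulrDr [X in X <= _](_ : _ = dd f D i j ^+ 4 *
    (fine (P [set w | margin f S T i j w <= 0]) * denom m f D i j)); last by ring.
  by rewrite ler_pM2l// exprn_gt0.
(* Since [tb] is an arbitrary function of the set of minimisers, the event is split by the value of
   that set: a finite union of events, each a finite intersection of comparisons of distances or
   their complements. *)
have mE i : measurable [set w | yhat f S tb (f (T i w)) w != i].
  have marg A : measurable [set w | argmin_set f S (f (T i w)) w = A].
    have mc c : measurable [set w | c \in argmin_set f S (f (T i w)) w].
      rewrite (_ : [set w | _] = \bigcap_(c' in [set: 'I_C])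
        [set w | sqnorm (f (T i w) - muhat f S c w) -
                 sqnorm (f (T i w) - muhat f S c' w) <= 0]).
        apply: fin_bigcap_measurable; first exact: finite_finset.
        by move=> c' _; apply: measurable_le0; exact: measurable_funB.
      apply/seteqP; split => w /=; rewrite inE.
        by move=> /forallP H c' _ /=; rewrite subr_le0.
      by move=> H; apply/forallP => c'; rewrite -subr_le0; exact: H.
    rewrite (_ : [set w | _] = \bigcap_(c in [set: 'I_C])
        (if c \in A then [set w | c \in argmin_set f S (f (T i w)) w]
         else ~` [set w | c \in argmin_set f S (f (T i w)) w])).
      apply: fin_bigcap_measurable; first exact: finite_finset.
      by move=> c _; case: ifP => _ //; exact: measurableC.
    apply/seteqP; split => w /=.
      by move=> <- c _ /=; case: ifPn => // /negP.
    move=> H; apply/setP => c; have := H c Logic.I.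
    by case: (c \in A) => //= /negP/negPf.
  rewrite (_ : [set w | _] = \bigcup_(A in [set A | tb A != i])
     [set w | argmin_set f S (f (T i w)) w = A]).
    apply: fin_bigcup_measurable => //; exact: finite_finset.
  apply/seteqP; split => w /=.
    by move=> H; exists (argmin_set f S (f (T i w)) w).
  by move=> [A /= H E]; rewrite /yhat E.
have union i : (P [set w | yhat f S tb (f (T i w)) w != i] <=
    \sum_(j | j != i) P [set w | (margin f S T i j w <= 0)%R])%E.
  apply: measure_bigcup_fin_le => //.
    by move=> j; exact: measurable_le0.
  move=> w /= yi; apply: contrapT => H.
  have Hpos j : j != i -> 0 < margin f S T i j w.
    by move=> ji; rewrite ltNge; apply/negP => ?; apply: H; exists j.
  (* If all margins are positive, [i] is the unique minimiser, and any tie-breaking rule must return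
     it. *)
  have ai : argmin_set f S (f (T i w)) w = [set i]%SET.
    apply/setP => c; rewrite !inE; have [->|ci] := eqVneq c i.
      apply/forallP => c'; have [->//|ci'] := eqVneq c' i.
      by have := Hpos _ ci'; rewrite subr_gt0 => /ltW.
    apply/negbTE/negP => /forallP/(_ i); rewrite leNgt => /negP; apply.
    by have := Hpos _ ci; rewrite subr_gt0.
  have iN0 : [set i]%SET != finset.set0 by apply/set0Pn; exists i; rewrite inE.
  by move: yi; rewrite /yhat ai; have := htb _ iN0; rewrite inE => ->.
have Cn0 : (0 : R) <= C%:R^-1 by rewrite invr_ge0.
rewrite /errNCC /ncc_bound -mulrDr EFinM; apply: lee_wpmul2l; first by rewrite lee_fin.
rewrite -big_split/= -sumEFin; apply: lee_sum => i _.
apply: le_trans (union i) _.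
rewrite -big_split/= -sumEFin; apply: lee_sum => j ji.
by apply: pair; rewrite eq_sym.
Qed.
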